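(* Let $f_1,\dots,f_M:\mathbb{R}^D\to\mathbb{R}$ be $\mathcal{C}^4$, let $y_1,\dots,y_M\in\mathbb{R}$, and let $\ell:\mathbb{R}\times\mathbb{R}\to\mathbb{R}$ be such that $\ell(y',y)$ is $\mathcal{C}^4$ in $y'$, $\arg\min_{y'\in\mathbb{R}}\ell(y',y)=y$ and $\frac{\partial^2\ell(y',y)}{(\partial y')^2}\big|_{y'=y}>0$ for every $y\in\mathbb{R}$. Let $L_k(x)=\ell(f_k(x),y_k)$, $L=\frac1M\sum_{k=1}^ML_k$, and assume that $$\Gamma=\{x\in\mathbb{R}^D: f_k(x)=y_k\ \forall k\in[M],\ \{\nabla f_k(x)\}_{k=1}^M\text{ linearly independent}\}$$ is non-empty. Then the limiting regularizers (functions on $\Gamma$) $\widetilde S^{\mathrm{Max}},\widetilde S^{\mathrm{Asc}},\widetilde S^{\mathrm{Avg}}$ of the stochastic sharpness notions $\mathbb{E}_k[R^{\mathrm{Max}}_{k,\rho}]$, $\mathbb{E}_k[R^{\mathrm{Asc}}_{k,\rho}]$, $\mathbb{E}_k[R^{\mathrm{Avg}}_{k,\rho}]$ satisfy $$\widetilde S^{\mathrm{Max}}(x)=\widetilde S^{\mathrm{Asc}}(x)=D\cdot\widetilde S^{\mathrm{Avg}}(x)=\mathrm{Tr}(\nabla^2L(x))/2 .$$ Furthermore, extend $\widetilde S^{\mathrm{type}}$ to all of $\mathbb{R}^D$ by these formulas, let $U$ be the attraction set of $\Gamma$ under the gradient flow of $L$, and let $U'$ be any bounded open set with $\overline{U'}\subseteq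 U$ and $\overline{U'}\cap\Gamma\subseteq\overline{U'\cap\Gamma}$. For any $\mathrm{type}\in\{\mathrm{Max},\mathrm{Asc},\mathrm{Avg}\}$ and any $\epsilon>0$, there is a function $\omega:\mathbb{R}^+\to\mathbb{R}^+$ with $\lim_{\rho\to0}\omega(\rho)=0$ such that for all sufficiently small $\rho>0$: if $u\in U'$ satisfies $$L(u)+\mathbb{E}_k[R^{\mathrm{type}}_{k,\rho}(u)]\le\inf_{x\in U'}\bigl(L(x)+\mathbb{E}_k[R^{\mathrm{type}}_{k,\rho}(x)]\bigr)+\epsilon\rho^2,$$ then $$L(u)-\inf_{x\in U'}L(x)\le\epsilon\rho^2+\omega(\rho)\rho^2\quad\text{and}\quad\Bigl|\widetilde S^{\mathrm{type}}(u)-\inf_{x\in U'\cap\Gamma}\widetilde S^{\mathrm{type}}(x)\Bigr|\le\epsilon+\omega(\rho).$$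
   Context: $\mathbb{E}_k$ is the expectation over $k$ uniform on $[M]=\{1,\dots,M\}$. For each $k$ and $\rho>0$: - $R^{\mathrm{Max}}_{k,\rho}(x)=\max_{\|v\|_2\le1}L_k(x+\rho v)-L_k(x)$; - $R^{\mathrm{Asc}}_{k,\rho}(x)=L_k\bigl(x+\rho\nabla L_k(x)/\|\nabla L_k(x)\|_2\bigr)-L_k(x)$ if $\nabla L_k(x)\neq0$, and $=\infty$ if $\nabla L_k(x)=0$; - $R^{\mathrm{Avg}}_{k,\rho}(x)=\mathbb{E}_{g\sim N(0,I)}L_k(x+\rho g/\|g\|_2)-L_k(x)$. The limiting regularizer of a family $\{R_\rho\}_{\rho>0}$ of functions $\mathbb{R}^D\to\mathbb{R}\cup\{\infty\}$ is the function $S:\Gamma\to\mathbb{R}$, $S(x)=\lim_{\rho\to0}\lim_{r\to0}\inf_{\|x'-x\|_2\le r}R_\rho(x')/\rho^2$. Gradient flow: $\phi(x,\tau)=x-\int_0^\tau\nabla L(\phi(x,t))\,dt$, $\Phi(x)=\lim_{\tau\to\infty}\phi(x,\tau)$ when it exists; $U=\{x:\Phi(x)\text{ exists and }\Phi(x)\in\Gamma\}$.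
   Formalization: The set U'∩Γ is additionally assumed non-empty; otherwise the infimum of the limiting regularizer over U'∩Γ is over the empty set and the second bound fails (e.g. D=M=1, f=id, y=0, squared loss, U'=(1,2)). *)

(* Defs.v *)
From HB Require Import structures.
From mathcomp Require Import all_boot all_order all_algebra.
From mathcomp Require Import all_classical all_reals all_analysis.
Set Implicit Arguments.
Unset Strict Implicit.
Unset Printing Implicit Defensive.
Import Order.TTheory GRing.Theory Num.Theory.
Import numFieldNormedType.Exports.
Local Open Scope classical_set_scope.
Local Open Scope ring_scope.

(* The topology on 'rV[R]_D is that of the library's max norm; it coincides
   with the Euclidean topology. Only the metric notions below need l2norm. *)
Definition l2norm (R : realType) (D : nat) (v : 'rV[R]_D) : R :=
  Num.sqrt (\sum_i v 0 i ^+ 2).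

(* C^n in finite dimension: C^(n+1) iff differentiable with all directional
   derivatives of class C^n. *)
Fixpoint Cn (R : realType) (V : normedModType R) (n : nat) (f : V -> R) : Prop :=
  match n with
  | 0 => continuous f
  | m.+1 => (forall x, differentiable f x) /\
            (forall v, Cn m (fun x => 'D_v f x))
  end.

Section Calculus.
Variables (R : realType) (D : nat).
Implicit Types (F : 'rV[R]_D -> R) (x : 'rV[R]_D).

Definition grad F x : 'rV[R]_D := \row_i 'D_(delta_mx 0 i) F x.

Definition hessian F x : 'M[R]_D := 'J (grad F) x.

End Calculus.

Section StandardGaussian.
Variable R : realType.
Local Notation RT := (measurableTypeR R).

Definition cons_tuple_fun (n : nat) (p : RT * n.-tuple RT) : n.+1.-tuple RT :=
  [tuple of p.1 :: p.2].

Lemma measurable_cons_tuple_fun n :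
  measurable_fun [set: RT * n.-tuple RT] (@cons_tuple_fun n).
Proof. exact: measurable_cons. Qed.

HB.instance Definition _ n := isMeasurableFun.Build _ _ _ _
  (@cons_tuple_fun n) (@measurable_cons_tuple_fun n).

(* N(0, I_n), the law of n independent N(0, 1) coordinates, built as an
   iterated product measure. *)
Fixpoint std_gaussian (n : nat) : probability (n.-tuple RT) R :=
  match n with
  | 0 => dirac [tuple]
  | m.+1 => distribution (normal_prob 0 1 \x std_gaussian m)%E
              (@cons_tuple_fun m)
  end.

Definition row_of_tuple (n : nat) (g : n.-tuple RT) : 'rV[R]_n :=
  \row_i tnth g i.

End StandardGaussian.

Inductive sharpness := Max | Asc | Avg.

Section Sharpness.
Variables (R : realType) (D : nat).
Implicit Types (F : 'rV[R]_D -> R) (rho : R) (x : 'rV[R]_D).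
Local Open Scope ereal_scope.

(* For continuous F the supremum is attained. *)
Definition sharp_max F rho x : \bar R :=
  ereal_sup [set (F (x + rho *: v)%R - F x)%:E | v in [set v | l2norm v <= 1]%R].

Definition sharp_asc F rho x : \bar R :=
  if grad F x == 0%R then +oo
  else (F (x + rho *: ((l2norm (grad F x))^-1 *: grad F x))%R - F x)%:E.

Definition sharp_avg F rho x : \bar R :=
  \int[std_gaussian R D]_g
     (let v := row_of_tuple g in
      F (x + rho *: ((l2norm v)^-1 *: v))%R)%:E
  - (F x)%:E.

Definition sharp (t : sharpness) : ('rV[R]_D -> R) -> R -> 'rV[R]_D -> \bar R :=
  match t with
  | Max => sharp_max
  | Asc => sharp_asc
  | Avg => sharp_avg
  end.

Definition stoch_sharp (t : sharpness) (M : nat) (Lk : 'I_M -> 'rV[R]_D -> R)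
    rho x : \bar R :=
  (M%:R^-1)%:E * \sum_(k < M) sharp t (Lk k) rho x.

(* Both limits are required to exist, the outer one being finite. *)
Definition limiting_regularizer (G : set 'rV[R]_D)
    (Rf : R -> 'rV[R]_D -> \bar R) (S : 'rV[R]_D -> R) : Prop :=
  forall x, G x -> exists2 h : R -> \bar R,
    (forall rho : R, (0 < rho)%R ->
      ereal_inf [set Rf rho x' * ((rho ^+ 2)^-1)%:E
                | x' in [set x' | l2norm (x' - x) <= r]%R]
        @[r --> 0^'+] --> h rho) &
    h rho @[rho --> 0^'+] --> (S x)%:E.

End Sharpness.

Section GradientFlow.
Variables (R : realType) (D : nat).
Implicit Types (F : 'rV[R]_D -> R) (x : 'rV[R]_D).

Definition gradient_flow F x (phi : R -> 'rV[R]_D) : Prop :=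
  {within `[0, +oo[, continuous phi} /\
  forall tau, 0 <= tau ->
    phi tau = x - \row_j \int[lebesgue_measure]_(t in `[0, tau])
                           grad F (phi t) 0 j.

(* For F of class C^2 the trajectory phi is unique. *)
Definition attraction_set F (G : set 'rV[R]_D) : set 'rV[R]_D :=
  [set x | exists phi, gradient_flow F x phi /\
           exists2 p, G p & phi tau @[tau --> +oo] --> p].

End GradientFlow.

Section Interpolation.
Variables (R : realType) (D M : nat).
Variables (ell : R -> R -> R) (f : 'I_M -> 'rV[R]_D -> R) (y : 'I_M -> R).

Definition loss_k (k : 'I_M) (x : 'rV[R]_D) : R := ell (f k x) (y k).

Definition loss (x : 'rV[R]_D) : R := M%:R^-1 * \sum_(k < M) loss_k k x.

Definition interp_manifold : set 'rV[R]_D :=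
  [set x | (forall k, f k x = y k) /\
           row_free (\matrix_(k < M) grad (f k) x)].

End Interpolation.

(* Main.v *)
Require Import Defs.
From mathcomp Require Import all_boot all_order all_algebra.
From mathcomp Require Import fingroup perm.
From mathcomp Require Import all_classical all_reals all_analysis.
From mathcomp Require Import measurable_realfun ring lra.
Import Order.TTheory GRing.Theory Num.Theory.
Import numFieldNormedType.Exports.
Local Open Scope classical_set_scope.
Local Open Scope ring_scope.

(* At an interpolating point x each L_k has zero gradient and rank-one Hessian
   c_k g_k g_k^T, with g_k the gradient of f_k, so its largest eigenvalue is its
   trace.  A second-order Taylor expansion, uniform for base points near x and
   small rho, gives E_k[R_rho] >= rho^2 (S(x) - d) at all points near x: choose
   v = +-g_k/|g_k| for Max; for Asc the normalised gradient is automatically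
   +-g_k/|g_k|; for Avg use E[v] = 0 and E[v v^T] = I/D on the sphere.  The
   matching upper bound holds at points arbitrarily close to x (for Asc one has
   to leave x along a direction w with g_k.w = 1 for all k, where no gradient
   vanishes).  These two bounds give the limiting regularizer.  For the second
   part, compactness of the closure of U' localises near-minimisers near zeros
   of L - min L, and such a zero in the attraction set lies in Gamma because the
   gradient flow started there is constant. *)

(** * Euclidean norm and uniform second-order Taylor expansion *)

(** The lower and upper bounds on the sharpness carry different quantifiers, dictated by the double
    limit. An infimum over shrinking balls needs the lower bound at every [x'] near [x], jointly
    with small [rho], and the compactness argument needs the same joint form. For the upper bound
    one point per neighbourhood is enough, and it may depend on [rho]. The obstacle behind this is
    the linear Taylor term [rho * dot (grad F x') v], which can dominate [rho ^+ 2]: in the lower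
    bounds it is nonnegative (Max, Asc) or averages to 0 (Avg), while in the upper bound for Max and
    Asc it is made negligible by moving [x'] towards [x], where the gradient vanishes, once [rho] is
    fixed. Where [L] exceeds its minimum only a bound [- d] on the sharpness is available; it
    suffices because the excess of [L] is not scaled by [rho ^+ 2]. The near-minimiser estimates are
    proved with an arbitrary constant [d] in place of [omega rho]; the rate is extracted at the end
    by monotonicity in [d]. *)

Lemma cvg_sumr {R : realType} {T : Type} (F : set_system T) {FF : Filter F}
    (I : finType) (f : I -> T -> R) (a : I -> R) :
  (forall i, f i x @[x --> F] --> a i) ->
  \sum_i f i x @[x --> F] --> \sum_i a i.
Proof.
move=> fa; apply: (@cvg_big R I +%R 0 xpredT add_continuous) => //.
Qed.

Section l2norm.
Context {R : realType} {D : nat}.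
Implicit Types v w : 'rV[R]_D.

Lemma l2norm_ge0 v : 0 <= l2norm v.
Proof. exact: sqrtr_ge0. Qed.

Lemma l2normE v : l2norm v ^+ 2 = \sum_i v 0 i ^+ 2.
Proof. by rewrite sqr_sqrtr// sumr_ge0// => i _; exact: sqr_ge0. Qed.

Lemma l2norm0 : l2norm (0 : 'rV[R]_D) = 0.
Proof. by rewrite /l2norm big1 ?sqrtr0// => i _; rewrite mxE expr0n. Qed.

Lemma l2norm_eq0 v : (l2norm v == 0) = (v == 0).
Proof.
apply/idP/eqP => [/eqP v0|->]; last by rewrite l2norm0.
apply/rowP => i; rewrite mxE; apply/eqP; rewrite -sqrf_eq0; apply/eqP.
have /eqP : \sum_i v 0 i ^+ 2 = 0 by rewrite -l2normE v0 expr0n.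
rewrite psumr_eq0 => [/allP/(_ i)|j _]; last exact: sqr_ge0.
by rewrite mem_index_enum => /(_ isT)/eqP.
Qed.

Lemma l2norm_gt0 v : (0 < l2norm v) = (v != 0).
Proof. by rewrite lt_def l2norm_ge0 andbT l2norm_eq0. Qed.

Lemma l2normZ (a : R) v : l2norm (a *: v) = `|a| * l2norm v.
Proof.
rewrite /l2norm; under eq_bigr do rewrite mxE exprMn.
by rewrite -mulr_sumr sqrtrM ?sqr_ge0// sqrtr_sqr.
Qed.

Lemma coord_le_l2norm v i : `|v 0 i| <= l2norm v.
Proof.
rewrite -sqrtr_sqr ler_sqrt; last by apply: sumr_ge0 => j _; exact: sqr_ge0.
by rewrite (bigD1 i)//= lerDl sumr_ge0// => j _; exact: sqr_ge0.
Qed.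

Lemma l2norm_normalize v : v != 0 -> l2norm ((l2norm v)^-1 *: v) = 1.
Proof.
move=> v0; rewrite l2normZ ger0_norm ?invr_ge0 ?l2norm_ge0//.
by rewrite mulVf// l2norm_eq0.
Qed.

Lemma l2norm_normalize_le1 v : l2norm ((l2norm v)^-1 *: v) <= 1.
Proof.
have [->|/l2norm_normalize->//] := eqVneq v 0.
by rewrite scaler0 l2norm0.
Qed.

Lemma norm_le_l2norm v : `|v| <= l2norm v.
Proof.
rewrite [leLHS]/Num.Def.normr/= mx_normrE (bigmax_le _ (l2norm_ge0 _))//.
by move=> [i j] _ /=; rewrite (ord1 i); exact: coord_le_l2norm.
Qed.

Lemma coord_le_norm v i : `|v 0 i| <= `|v|.
Proof.
rewrite [leRHS]/Num.Def.normr/= mx_normrE.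
exact: (le_bigmax _ (fun ij => `|v ij.1 ij.2|) (0, i)).
Qed.

Lemma l2norm_le_norm v : l2norm v <= Num.sqrt D%:R * `|v|.
Proof.
rewrite -[leRHS]ger0_norm ?mulr_ge0 ?sqrtr_ge0// -sqrtr_sqr.
rewrite ler_sqrt ?sqr_ge0// exprMn sqr_sqrtr//.
apply: (@le_trans _ _ (\sum_(i < D) `|v| ^+ 2)).
  apply: ler_sum => i _; rewrite -real_normK ?num_real//.
  by rewrite ler_sqr ?nnegrE ?normr_ge0// coord_le_norm.
by rewrite sumr_const card_ord mulr_natl.
Qed.

(** Neighbourhoods come from the max norm, the regularizer uses Euclidean balls; this lemma and
    [l2ball_near] pass from one to the other. *)
Lemma near_l2ball (x : 'rV[R]_D) (P : 'rV[R]_D -> Prop) :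
  (\forall z \near x, P z) ->
  exists2 r : R, 0 < r & forall z, l2norm (z - x) <= r -> P z.
Proof.
move=> /nbhs_ballP[r /= r0 Pr]; exists (r / 2); first exact: divr_gt0.
move=> z zx; apply: Pr; rewrite -ball_normE/= distrC.
apply: (le_lt_trans (norm_le_l2norm _)); apply: (le_lt_trans zx).
by rewrite ltr_pdivrMr// ltr_pMr// ltr1n.
Qed.

Lemma l2ball_near (x : 'rV[R]_D) (r : R) : 0 < r ->
  \forall z \near x, l2norm (z - x) <= r.
Proof.
(* [sqrt D] is 0 in dimension 0; adding 1 keeps the radius positive. *)
move=> r0; have r'0 : 0 < r / (Num.sqrt D%:R + 1).
  by rewrite divr_gt0// ltr_wpDl// sqrtr_ge0.
have := @nbhsx_ballx _ _ x _ r'0; apply: filterS => z.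
rewrite -ball_normE/= distrC => /ltW zx.
apply: (le_trans (l2norm_le_norm _)).
rewrite -[leRHS](@divfK _ (Num.sqrt D%:R + 1)); last first.
  by rewrite gt_eqF// ltr_wpDl// sqrtr_ge0.
by rewrite mulrC ler_pM// ?sqrtr_ge0// lerDl.
Qed.

(** Source of the uniformity in the direction [v]: half of the radius is spent on [x'], the other
    half on the displacement. *)
Lemma near_translate (x : 'rV[R]_D) (P : 'rV[R]_D -> Prop) :
  (\forall z \near x, P z) ->
  \forall x' \near x & rho \near 0^'+, forall v (t : R),
    l2norm v <= 1 -> 0 <= t -> t <= rho -> P (x' + t *: v).
Proof.
move=> /nbhs_ballP[r /= r0 Pr].
near=> x' rho.
have rhor : rho <= r / 2.
  by near: rho; apply: nbhs_right_le; rewrite divr_gt0.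
have xx' : ball x (r / 2) x'.
  by near: x'; apply: nbhsx_ballx; rewrite divr_gt0.
move=> v t v1 t0 trho; apply: Pr; rewrite -ball_normE/= opprD addrA.
apply: (le_lt_trans (ler_normB _ _)); rewrite (splitr r) ltr_leD//.
  by move: xx'; rewrite -ball_normE.
rewrite normrZ (ger0_norm t0) -[leRHS]mulr1 ler_pM//.
  exact: le_trans trho rhor.
exact: le_trans (norm_le_l2norm _) v1.
Unshelve. all: by end_near. Qed.

End l2norm.

Section Cn_calculus.
Context {R : realType} {V : normedModType R}.
Implicit Types F G : V -> R.

Lemma Cn_continuous n F : Cn n F -> continuous F.
Proof.
case: n => [//|n [dF _]] x.
exact: differentiable_continuous.
Qed.

Lemma CnS n F : Cn n.+1 F -> Cn n F.
Proof.
elim: n F => [|n IH] F; first exact: Cn_continuous.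
by move=> [dF DF]; split=> // v; apply: IH; exact: DF.
Qed.

Lemma is_derive_line F (x v : V) (t : R) :
  differentiable F (x + t *: v) ->
  is_derive t 1 (fun t => F (x + t *: v)) ('D_v F (x + t *: v)).
Proof.
move=> dF0; have dF := @diff_derivable _ _ _ _ _ v dF0.
have E : (fun h : R => h^-1 *: (F (x + (h *: (1 : R) + t) *: v) - F (x + t *: v)))
       = (fun h : R => h^-1 *: (F (h *: v + (x + t *: v)) - F (x + t *: v))).
  apply/funext => h; congr (_ *: (F _ - _)).
  by rewrite [h *: 1]mulr1 scalerDl addrCA.
apply: DeriveDef.
  by rewrite /derivable/=/shift/=  [X in cvg (X @ _)]E.
by rewrite /derive/=/shift/= [X in lim (X @ _) = _]E.
Qed.

End Cn_calculus.

Section rV_calculus.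
Context {R : realType} {D : nat}.
Implicit Types (F G : 'rV[R]_D -> R) (x v w : 'rV[R]_D).

Definition dot v w : R := \sum_i v 0 i * w 0 i.

(** The quadratic form of the Hessian at [x], as a coordinate sum so that two base points can be
    compared entry by entry. *)
Definition d2 F x v : R := \sum_i \sum_j
  'D_(delta_mx 0 j) (fun z => 'D_(delta_mx 0 i) F z) x * v 0 i * v 0 j.

Lemma deriveE_sum F x v : differentiable F x ->
  'D_v F x = \sum_i v 0 i * 'D_(delta_mx 0 i) F x.
Proof.
move=> dF; rewrite deriveE// {1}(row_sum_delta v) linear_sum/=.
by apply: eq_bigr => i _; rewrite linearZ/= deriveE.
Qed.

Lemma derive_dot F x v : differentiable F x -> 'D_v F x = dot (grad F x) v.
Proof.
by move=> /deriveE_sum->; apply: eq_bigr => i _; rewrite mxE mulrC.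
Qed.

Lemma derive2E F x v : Cn 2 F ->
  'D_v (fun z => 'D_v F z) x = d2 F x v.
Proof.
move=> [dF DF].
have -> : (fun z => 'D_v F z) =
    \sum_(i < D) (v 0 i *: (fun z => 'D_(delta_mx 0 i) F z)).
  by apply/funext => z; rewrite fct_sumE deriveE_sum.
have dDF i z : differentiable (fun z => 'D_(delta_mx 0 i) F z) z.
  by have [+ _] := DF (delta_mx 0 i); exact.
rewrite derive_sum => [|i]; last exact/derivableZ/diff_derivable.
apply: eq_bigr => i _; rewrite deriveZ; last exact: diff_derivable.
rewrite deriveE_sum// scaler_sumr; apply: eq_bigr => j _.
by rewrite /GRing.scale/=; ring.
Qed.

(** Value and gradient are taken at the moving point [x'] but the quadratic term at the fixed [x];
    continuity of the second derivatives at [x] absorbs the discrepancy into [d]. *)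
Lemma taylor2 F x (d : R) : Cn 2 F -> 0 < d ->
  \forall x' \near x & rho \near 0^'+, forall v, l2norm v <= 1 ->
  `|F (x' + rho *: v) - F x' - rho * dot (grad F x') v - rho ^+ 2 / 2 * d2 F x v|
    <= d * rho ^+ 2.
Proof.
move=> F2 d0; have [dF DF] := F2.
(* For every [v] in the unit ball [osc z] bounds [|d2 F z v - d2 F x v|], since the coordinates of
   [v] are at most 1 in absolute value. *)
pose osc z := \sum_i \sum_j
  `|'D_(delta_mx 0 j) (fun z => 'D_(delta_mx 0 i) F z) z -
    'D_(delta_mx 0 j) (fun z => 'D_(delta_mx 0 i) F z) x|.
have osc_near : \forall z \near x, osc z <= d.
  have : osc z @[z --> x] --> (0 : R).
    rewrite [X in _ --> X](_ : 0 = osc x); last first.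
      by rewrite /osc big1// => i _; rewrite big1// => j _; rewrite subrr normr0.
    apply: (@cvg_sumr _ _ (nbhs x)) => i; apply: (@cvg_sumr _ _ (nbhs x)) => j.
    apply: (@cvg_norm _ _ _ (nbhs x)); apply: (@cvgB _ _ _ (nbhs x)); last exact: cvg_cst.
    by have [_ /(_ (delta_mx 0 j))] := DF (delta_mx 0 i); exact.
  move=> /cvgr0_norm_le/(_ _ d0); apply: filterS => z.
  by apply: le_trans; exact: ler_norm.
have := near_translate x _ osc_near; near_simpl.
apply: filter_app; near=> x' rho => /= oscv v v1.
have rho0 : 0 < rho by near: rho; exact: nbhs_right_gt.
pose K := d2 F x v.
pose phi t : R := F (x' + t *: v).
pose phi1 t : R := 'D_v F (x' + t *: v).
have dphi (t : R) : is_derive t (1 : R) phi (phi1 t) by exact: is_derive_line.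
have dphi1 (t : R) : is_derive t (1 : R) phi1 (d2 F (x' + t *: v) v).
  rewrite -(derive2E _ _ _ F2).
  exact: (@is_derive_line _ _ (fun z => 'D_v F z) _ _ _ ((DF v).1 _)).
(* [psi] is the second-order remainder along the segment and [psi1] its derivative. Both vanish at
   0, so two mean value steps give [psi rho = rho * xi * (d2 F (x' + eta *: v) v - K)] with
   [0 <= eta <= xi <= rho]. *)
pose psi1 t := phi1 t - phi1 0 - t * K.
pose psi t := phi t - phi 0 - t * phi1 0 - t ^+ 2 / 2 * K.
have dpsi1 (t : R) : is_derive t (1 : R) psi1 (d2 F (x' + t *: v) v - K).
  apply: is_derive_eq.
  by rewrite oppr0 /GRing.scale/=; ring.
have dpsi (t : R) : is_derive t (1 : R) psi (psi1 t).
  have -> : psi = (fun t => phi t - phi 0 - t * phi1 0 - (t * t) * (K / 2)).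
    by apply/funext => s; rewrite /psi; field.
  apply: is_derive_eq.
  by rewrite /psi1 /GRing.scale/=; field.
have cont (f df : R -> R) : (forall t, is_derive t (1 : R) f (df t)) -> continuous f.
  by move=> fE t; apply: differentiable_continuous; apply/derivable1_diffP; apply: ex_derive.
have [xi /[!in_itv]/= /andP[xi0 xir]] := MVT_segment (ltW rho0) (fun t _ => dpsi t)
  (continuous_subspaceT (cont _ _ dpsi)).
have [eta /[!in_itv]/= /andP[eta0 etar]] := MVT_segment xi0 (fun t _ => dpsi1 t)
  (continuous_subspaceT (cont _ _ dpsi1)).
have -> : psi1 0 = 0 by rewrite /psi1; ring.
have -> : psi 0 = 0 by rewrite /psi; ring.
rewrite !subr0 => psi1E psiE.
have -> : F (x' + rho *: v) - F x' - rho * dot (grad F x') v - rho ^+ 2 / 2 * d2 F x v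
    = psi rho.
  by rewrite /psi /phi /phi1 scale0r addr0 derive_dot.
rewrite psiE psi1E expr2 mulrA normrM (ger0_norm (ltW rho0)) ler_pM2r//.
rewrite normrM (ger0_norm xi0) ler_pM// ?normr_ge0//.
apply: le_trans (oscv v eta v1 eta0 (le_trans etar xir)).
rewrite /K /d2 /osc -sumrB (le_trans (ler_norm_sum _ _ _))//.
apply: ler_sum => i _; rewrite -sumrB (le_trans (ler_norm_sum _ _ _))//.
apply: ler_sum => j _; rewrite -!mulrBl !normrM -[leRHS]mulr1 -mulrA.
rewrite ler_wpM2l// mulr_ile1//.
  exact: le_trans (coord_le_l2norm _ _) v1.
exact: le_trans (coord_le_l2norm _ _) v1.
Unshelve. all: by end_near. Qed.

End rV_calculus.

Section hessian.
Context {R : realType} {D : nat}.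
Implicit Types (F G : 'rV[R]_D -> R) (x v w : 'rV[R]_D).

Lemma trace_hessian F x : Cn 2 F ->
  \tr (hessian F x) = \sum_i 'D_(delta_mx 0 i) (fun z => 'D_(delta_mx 0 i) F z) x.
Proof.
move=> [dF DF]; apply: eq_bigr => i _.
have dDF j z : differentiable (fun z => 'D_(delta_mx 0 j) F z) z := (DF _).1 z.
have dgrad : differentiable (grad F) x.
  have -> : grad F = \sum_(j < D) (fun z => 'D_(delta_mx 0 j) F z *: (delta_mx 0 j : 'rV[R]_D)).
    apply/funext => z; rewrite fct_sumE [LHS]row_sum_delta.
    by apply: eq_bigr => j _; rewrite mxE.
  by apply: differentiable_sum => j; exact: differentiableZl.
rewrite /hessian /jacobian mxE -deriveE// derive_mx; last exact: diff_derivable.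
by rewrite mxE; congr ('D_ _ _ x); apply/funext => z; rewrite mxE.
Qed.

Lemma dotC v w : dot v w = dot w v.
Proof. by apply: eq_bigr => i _; rewrite mulrC. Qed.

Lemma dotZl (a : R) v w : dot (a *: v) w = a * dot v w.
Proof. by rewrite /dot mulr_sumr; apply: eq_bigr => i _; rewrite mxE mulrA. Qed.

Lemma dotZr (a : R) v w : dot v (a *: w) = a * dot v w.
Proof. by rewrite dotC dotZl dotC. Qed.

Lemma dotvv v : dot v v = l2norm v ^+ 2.
Proof. by rewrite l2normE; apply: eq_bigr => i _; rewrite expr2. Qed.

Lemma grad_continuous F : Cn 1 F -> continuous (grad F).
Proof.
move=> [_ DF] x.
have -> : grad F = (fun z => \row_i 'D_(delta_mx 0 i) F z) by [].
apply/(@cvgrPdist_le _ _ _ (nbhs x)) => /= e e0; near=> z.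
rewrite [leLHS]/Num.Def.normr/= mx_normrE (bigmax_le _ (ltW e0))//= => -[i j] _.
rewrite !mxE/=; move: j; near: z; apply: filter_forall => /= j.
by move/(@cvgrPdist_le _ _ _ (nbhs x)) : (DF (delta_mx 0 j) x); exact.
Unshelve. all: by end_near. Qed.

Lemma dot_continuous v : continuous (dot v).
Proof.
move=> w; apply: (@cvg_sumr _ _ (nbhs w)) => i.
apply: (@cvgM _ _ (nbhs w)); first exact: cvg_cst.
exact: coord_continuous.
Qed.

End hessian.

(** * Chain rule to second order *)

Lemma derive_comp_gen {R : realType} {V : normedModType R}
    (g : R^o -> R) (f : V -> R) x v :
  differentiable g (f x) -> differentiable f x ->
  'D_v (g \o f) x = 'D_1 g (f x) * 'D_v f x.
Proof.
move=> dg df; rewrite deriveE; last exact: differentiable_comp.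
rewrite diff_comp//= -(@deriveE _ _ _ f x v df) (@deriveE _ _ _ g (f x) 1 dg).
have -> : 'D_v f x = 'D_v f x *: (1 : R^o) by rewrite [RHS]mulr1.
by rewrite linearZ/= [LHS]mulrC [_ *: 1]mulr1.
Qed.

Section composition.
Context {R : realType} {D : nat}.
Variables (g : R^o -> R) (f : 'rV[R]_D -> R).
Hypotheses (g2 : Cn 2 g) (f2 : Cn 2 f).
Let F x := g (f x).

Let dg a : differentiable g a := g2.1 a.
Let df x : differentiable f x := f2.1 x.

Lemma derive_comp x v : 'D_v F x = 'D_1 g (f x) * 'D_v f x.
Proof. exact: derive_comp_gen. Qed.

Lemma derive2_comp x v w : 'D_w (fun z => 'D_v F z) x =
  'D_1 (fun a => 'D_1 g a) (f x) * 'D_w f x * 'D_v f x +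
  'D_1 g (f x) * 'D_w (fun z => 'D_v f z) x.
Proof.
have dDf : differentiable ('D_v f) x := (f2.2 v).1 x.
have dDg a : differentiable ('D_1 g) a := (g2.2 1).1 a.
have -> : (fun z => 'D_v F z) = ('D_1 g \o f) * 'D_v f.
  by apply/funext => z; exact: derive_comp.
have dgf : differentiable ('D_1 g \o f) x by exact: differentiable_comp.
rewrite deriveM; [|exact: diff_derivable..].
rewrite (derive_comp_gen _ _ _ _ (dDg _) (df x)) /GRing.scale/=.
by rewrite addrC; congr (_ + _); rewrite mulrC.
Qed.

Lemma Cn2_comp : Cn 2 F.
Proof.
have dDf v x : differentiable ('D_v f) x := (f2.2 v).1 x.
have dDg a : differentiable ('D_1 g) a := (g2.2 1).1 a.
have E v : 'D_v F = ('D_1 g \o f) * 'D_v f.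
  by apply/funext => x; exact: derive_comp.
have cf := Cn_continuous _ _ f2.
split=> [x|v]; first exact: (differentiable_comp (df x) (dg (f x))).
split=> [x|w x].
  rewrite E; apply: differentiableM => //.
  exact: differentiable_comp.
rewrite (_ : 'D_w _ = (fun x => 'D_1 (fun a => 'D_1 g a) (f x) * 'D_w f x * 'D_v f x +
  'D_1 g (f x) * 'D_w (fun z => 'D_v f z) x)); last first.
  by apply/funext => z; exact: derive2_comp.
have c1 : {for x, continuous (fun z => 'D_1 g (f z))}.
  apply: (@continuous_comp _ _ _ f ('D_1 g)); first exact: cf.
  by apply: differentiable_continuous.
have c2 : {for x, continuous (fun z => 'D_1 (fun a => 'D_1 g a) (f z))}.
  apply: (@continuous_comp _ _ _ f ('D_1 ('D_1 g))); first exact: cf.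
  exact: ((g2.2 1).2 1).
have c3 u : {for x, continuous (fun z => 'D_u f z)}.
  exact: differentiable_continuous.
apply: (@cvgD _ _ _ (nbhs x) (nbhs_filter x)).
  apply: (@cvgM _ _ (nbhs x) (nbhs_filter x)); last exact: c3.
  by apply: (@cvgM _ _ (nbhs x) (nbhs_filter x)); [exact: c2|exact: c3].
by apply: (@cvgM _ _ (nbhs x) (nbhs_filter x)); [exact: c1|exact: ((f2.2 v).2 w)].
Qed.

End composition.

(** * Symmetries and moments of the normalised Gaussian vector *)

Section gaussian_symmetry.
Context {R : realType}.
Local Notation RT := (measurableTypeR R).
Local Open Scope ereal_scope.

(** The density is even and Lebesgue measure is invariant under negation, so the image measure is
    the original one. *)
Lemma normal_probN (G : RT -> \bar R) :
  measurable_fun setT G -> (forall a, 0 <= G a) ->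
  \int[normal_prob 0 1]_a G (- a)%R = \int[normal_prob 0 1]_a G a.
Proof.
move=> mG G0.
have mN : measurable_fun setT (-%R : RT -> RT) by exact: oppr_measurable.
rewrite -[LHS](@ge0_integral_pushforward _ _ _ _ R (-%R : RT -> RT) mN
  (normal_prob 0 1) setT G)//.
apply: eq_measure_integral => A mA _.
rewrite /pushforward/= /normal_prob.
transitivity (\int[lebesgue_measure]_(x in -%R @^-1` A)
    ((fun x => (normal_pdf 0 1 x)%:E) \o (-%R : RT -> RT)) x).
  apply: eq_integral => x _ /=; congr (_%:E).
  by rewrite /normal_pdf oner_eq0 /normal_fun !subr0 sqrrN.
rewrite -[LHS](@ge0_integral_pushforward _ _ RT RT R (-%R : RT -> RT) mN
  lebesgue_measure A (fun x : RT => (normal_pdf 0 1 x)%:E))//.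
- by apply: eq_measure_integral => B mB _; exact: lebesgue_measureN.
- apply: measurable_funTS; apply/measurable_EFinP.
  exact: measurable_normal_pdf.
- by move=> x _; rewrite lee_fin normal_pdf_ge0.
Qed.

Lemma normal_prob_set1 (a : R) : normal_prob 0 1 [set a] = 0 :> \bar R.
Proof.
have /null_content_dominatesP dom := @normal_prob_dominates R 0 1.
by apply: dom; [exact: measurable_set1|exact: lebesgue_measure_set1].
Qed.

(** These symmetries determine the first two moments on the sphere: sign flips kill the means and
    the mixed moments, swaps equate the squares. Acting coordinate by coordinate, they fit the
    iterated product measure. *)
Definition signed_perm {n} (s : 'I_n -> R) (p : {perm 'I_n}) (g : n.-tuple RT) : n.-tuple RT :=
  [tuple (s i * tnth g (p i))%R | i < n].

Lemma measurable_signed_perm n (s : 'I_n -> R) p :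
  measurable_fun setT (signed_perm s p).
Proof.
apply/measurable_fun_tnthP => i.
rewrite (_ : _ \o _ = (fun g => s i * tnth g (p i))%R); last first.
  by apply/funext => g /=; rewrite tnth_mktuple.
by apply: measurable_funM => //; exact: measurable_tnth.
Qed.

Lemma ge0_integral_std_gaussianS n (f : n.+1.-tuple RT -> \bar R) :
  measurable_fun setT f -> (forall g, 0 <= f g) ->
  \int[std_gaussian R n.+1]_g f g =
  \int[normal_prob 0 1]_a \int[std_gaussian R n]_t f [tuple of a :: t].
Proof.
move=> mf f0 /=.
rewrite ge0_integral_distribution//.
rewrite (@fubini_tonelli1 _ _ _ _ _ (normal_prob 0 1) (std_gaussian R n)
  (f \o @cons_tuple_fun R n))//; last by move=> x; exact: f0.
by apply: (measurableT_comp mf); exact: measurable_cons_tuple_fun.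
Qed.

Lemma measurable_integral_cons n (f : n.+1.-tuple RT -> \bar R) :
  measurable_fun setT f -> (forall g, 0 <= f g) ->
  measurable_fun setT (fun a => \int[std_gaussian R n]_t f [tuple of a :: t]).
Proof.
move=> mf f0.
apply: (@measurable_fun_fubini_tonelli_F _ _ _ _ _ (std_gaussian R n)
  (f \o @cons_tuple_fun R n)) => [|x]; last exact: f0.
by apply: (measurableT_comp mf); exact: measurable_cons_tuple_fun.
Qed.

Lemma measurable_consl n (a : RT) :
  measurable_fun setT (fun t : n.-tuple RT => [tuple of a :: t]).
Proof. exact: measurable_cons. Qed.

(** Restricted to nonnegative integrands, where Tonelli applies without integrability; signed ones
    follow by splitting into positive and negative parts. *)
Definition preserves_gaussian n (h : n.-tuple RT -> n.-tuple RT) :=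
  forall f, measurable_fun setT f -> (forall g, 0 <= f g) ->
  \int[std_gaussian R n]_g f (h g) = \int[std_gaussian R n]_g f g.

(** Inductive step for maps that leave the first coordinate alone: Tonelli isolates it, and the
    inner integral is over [n] coordinates. *)
Lemma preserves_gaussian_cons n (h : n.-tuple RT -> n.-tuple RT)
    (h' : n.+1.-tuple RT -> n.+1.-tuple RT) :
  measurable_fun setT h' ->
  (forall (a : RT) (t : n.-tuple RT), h' [tuple of a :: t] = [tuple of a :: h t]) ->
  preserves_gaussian n h -> preserves_gaussian n.+1 h'.
Proof.
move=> mh' h'E inv f mf f0.
rewrite (ge0_integral_std_gaussianS _ _ mf f0) (ge0_integral_std_gaussianS _
  (fun g => f (h' g)) (measurableT_comp mf mh') (fun=> f0 _)).
apply: eq_integral => a _.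
under eq_integral do rewrite h'E.
rewrite (inv (fun t => f [tuple of a :: t]))//.
exact: (measurableT_comp mf (measurable_consl _ _)).
Qed.

Definition flip {n} (i j : 'I_n) : R := (if j == i then -1 else 1)%R.

(** Coordinates are peeled off until the flipped one comes first, where [normal_probN] applies. *)
Lemma preserves_gaussian_flip n (i : 'I_n) : preserves_gaussian n (signed_perm (flip i) 1%g).
Proof.
elim: n i => [[]//|n IH i].
have [j ->|->] := unliftP ord0 i.
  apply: (preserves_gaussian_cons n (signed_perm (flip j) 1%g)) => // [|a t].
    exact: measurable_signed_perm.
  apply: eq_from_tnth => k; rewrite tnth_mktuple perm1.
  have [l ->|->] := unliftP ord0 k.
    by rewrite !tnthS tnth_mktuple perm1 /flip (inj_eq lift_inj).
  by rewrite !tnth0 /flip mul1r.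
move=> f mf f0.
rewrite (ge0_integral_std_gaussianS _ _ mf f0) (ge0_integral_std_gaussianS _
  (fun g => f (signed_perm (flip ord0) 1%g g)) (measurableT_comp mf (measurable_signed_perm _ _ _))
  (fun=> f0 _)).
rewrite -[RHS](normal_probN (fun a => \int[std_gaussian R n]_t f [tuple of a :: t])); first last.
- by move=> a; exact: integral_ge0.
- exact: measurable_integral_cons.
apply: eq_integral => a _; apply: eq_integral => t _; congr (f _).
apply: eq_from_tnth => k; rewrite tnth_mktuple perm1.
have [l ->|->] := unliftP ord0 k.
  by rewrite !tnthS /flip mul1r.
by rewrite !tnth0 /flip eqxx mulN1r.
Qed.

(** After peeling, the two neighbours are the first two coordinates, and exchanging them is an
    exchange of two integrals. Adjacent swaps already connect all indices. *)
Lemma preserves_gaussian_swap n (i j : 'I_n) : j = i.+1 :> nat ->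
  preserves_gaussian n (signed_perm (fun=> 1%R) (tperm i j)).
Proof.
elim: n i j => [[]//|n IH i j ij].
have [j' jE|j0] := unliftP ord0 j; last by rewrite j0 in ij.
have [i' iE|i0] := unliftP ord0 i.
  apply: (preserves_gaussian_cons n (signed_perm (fun=> 1%R) (tperm i' j'))) => [|a t|].
  - exact: measurable_signed_perm.
  - apply: eq_from_tnth => k; rewrite tnth_mktuple mul1r iE jE.
    have [l ->|->] := unliftP ord0 k.
      by rewrite -(inj_tperm _ _ _ lift_inj) !tnthS tnth_mktuple mul1r.
    by rewrite tpermD// eq_sym neq_lift.
  - by apply: IH; move: ij; rewrite iE jE /= /bump/= !add1n => -[].
subst i j; case: n j' ij {IH} => [[]//|n] j' ij f mf f0.
have {ij}-> : j' = ord0 by apply: val_inj; move: ij => /= [].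
have mact := measurable_signed_perm n.+2 (fun=> 1%R) (tperm ord0 (lift ord0 ord0)).
pose F (ab : RT * RT) := \int[std_gaussian R n]_t f [tuple of ab.1 :: [tuple of ab.2 :: t]].
have mcc : measurable_fun setT
    (fun abt : (RT * RT) * n.-tuple RT => f [tuple of abt.1.1 :: [tuple of abt.1.2 :: abt.2]]).
  apply: measurableT_comp => //; apply: measurable_cons.
    by apply: measurableT_comp => //; exact: measurable_fst.
  apply: measurable_cons; last exact: measurable_snd.
  by apply: measurableT_comp => //; exact: measurable_snd.
have mF : measurable_fun setT F.
  exact: (@measurable_fun_fubini_tonelli_F _ _ _ _ _ (std_gaussian R n) _ mcc).
have F0 ab : 0 <= F ab by exact: integral_ge0.
have cons_meas a : measurable_fun setT (fun t : n.+1.-tuple RT => f [tuple of a :: t]).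
  exact: (measurableT_comp mf (measurable_consl _ _)).
have E (h : n.+2.-tuple RT -> \bar R) : measurable_fun setT h -> (forall g, 0 <= h g) ->
  \int[std_gaussian R n.+2]_g h g = \int[normal_prob 0 1]_a \int[normal_prob 0 1]_b
    \int[std_gaussian R n]_t h [tuple of a :: [tuple of b :: t]].
  move=> mh h0; rewrite ge0_integral_std_gaussianS//; apply: eq_integral => a _.
  rewrite ge0_integral_std_gaussianS//.
  exact: (measurableT_comp mh (measurable_consl _ _)).
rewrite (E _ mf f0) (E (fun g => f (signed_perm (fun=> 1%R) (tperm ord0 (lift ord0 ord0)) g))
  (measurableT_comp mf mact) (fun=> f0 _)).
rewrite [RHS](@fubini_tonelli _ _ _ _ _ (normal_prob 0 1) (normal_prob 0 1) F mF F0).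
apply: eq_integral => a _; apply: eq_integral => b _.
rewrite /F/=; apply: eq_integral => t _; congr (f _).
apply: eq_from_tnth => k; rewrite tnth_mktuple mul1r.
have [l ->|->] := unliftP ord0 k; last by rewrite tpermL !tnthS !tnth0.
have [m ->|->] := unliftP ord0 l; last by rewrite tpermR !tnthS !tnth0.
rewrite tpermD ?neq_lift// ?(inj_eq lift_inj) ?neq_lift//.
by rewrite !tnthS.
Qed.

End gaussian_symmetry.

(** The open set [F > a] is a countable union of boxes with rational centres, and the preimage of a
    box is measurable coordinate by coordinate. *)
Lemma measurable_continuous_rV {R : realType} {D : nat} {d : measure_display}
    (T : measurableType d) (u : T -> 'rV[R]_D) (F : 'rV[R]_D -> R) :
  (forall i, measurable_fun setT (fun t => u t 0 i)) -> continuous F ->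
  measurable_fun setT (F \o u).
Proof.
move=> mu cF; apply: (measurability _ (RGenOInfty.measurableE R)).
move=> /= _ [_ [a ->]] <-; rewrite setTI.
pose A := F @^-1` `]a, +oo[.
have oA : open A by apply: open_comp => [z _|]; [exact: cF|exact: interval_open].
pose box (qk : 'rV[rat]_D * nat) : set 'rV[R]_D :=
  [set w | forall i, `|w 0 i - ratr (qk.1 0 i)| < qk.2.+1%:R^-1].
(* Boxes that leave [A] are replaced by the empty set, so that the union runs over a whole countable
   type. *)
pose B qk := if pselect (box qk `<=` A) then u @^-1` (box qk) else set0.
suff -> : (F \o u) @^-1` `]a, +oo[ = \bigcup_qk B qk.
  apply: countable_bigcupT_measurable => [|qk]; first exact: countableP.
  rewrite /B; case: (pselect _) => ? /=; last exact: measurable0.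
  rewrite (_ : _ @^-1` _ = \bigcap_(i in [set: 'I_D])
    (fun t => u t 0 i - ratr (qk.1 0 i)) @^-1` `](- qk.2.+1%:R^-1), qk.2.+1%:R^-1[); last first.
    apply/seteqP; split => t /= h i; first by move=> _; rewrite /= in_itv/= -ltr_norml; exact: h.
    by have := h i I; rewrite /= in_itv/= -ltr_norml.
  apply: fin_bigcap_measurable => [|i _]; first exact: finite_finset.
  rewrite -[X in measurable X]setTI.
  by apply: measurable_funB => //; exact: measurable_cst.
apply/seteqP; split => t /=; last first.
  by move=> [qk _]; rewrite /B; case: (pselect _) => [sub /sub|].
move=> Aut; have /nbhs_ballP[r /= r0 rA] : nbhs (u t) A by exact: open_nbhs_nbhs.
(* A point of the chosen box is within two box radii of [u t]: one from each of them to the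
   centre. *)
have [k kr] : exists k : nat, k.+1%:R^-1 < r / 2.
  have [k] := @ltr_add_invr R 0 (r / 2) (divr_gt0 r0 (ltr0Sn _ 1)).
  by rewrite add0r; exists k.
have k0 : 0 < k.+1%:R^-1 :> R by rewrite invr_gt0.
have /choice[q qE] : forall i, exists q : rat, `|u t 0 i - ratr q| < k.+1%:R^-1.
  move=> i; have [|q] := @rat_in_itvoo _ (u t 0 i - k.+1%:R^-1) (u t 0 i + k.+1%:R^-1).
    by rewrite ltrD2l gtrN.
  rewrite in_itv/= => qE; exists q; rewrite ltr_norml; move: qE.
  by move: (k.+1%:R^-1) (ratr q) => c q' /andP[? ?]; apply/andP; split; lra.
exists (\row_i q i, k) => //; rewrite /B; case: (pselect _) => [?|]; first by move=> i; rewrite mxE.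
move=> nsub; exfalso; apply: nsub => z zq; apply: rA; rewrite -ball_normE/=.
rewrite [ltLHS]/Num.Def.normr/= mx_normrE; apply/bigmax_ltP; split=> // -[i0 j] _ /=.
rewrite (ord1 i0) !mxE.
move: kr (qE j) (zq j); rewrite /= mxE !ltr_norml.
move: (k.+1%:R^-1) (ratr (q j)) => c q' ? /andP[? ?] /andP[? ?].
by apply/andP; split; lra.
Qed.

(** * Mean and second moments of the normalised vector *)

Section unit_gaussian.
Context {R : realType}.
Local Notation RT := (measurableTypeR R).

(** The zero tuple is sent to 0 because [0^-1 = 0]; hence the norm is at most 1 everywhere, and 1
    off a null set. *)
Definition normalize {n} (g : n.-tuple RT) : 'rV[R]_n :=
  let v := row_of_tuple g in (l2norm v)^-1 *: v.

Lemma measurable_normalize n (i : 'I_n) :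
  measurable_fun setT (fun g : n.-tuple RT => normalize g 0 i).
Proof.
have mt j : measurable_fun setT (fun g : n.-tuple RT => tnth g j : R).
  exact: measurable_tnth.
have -> : (fun g : n.-tuple RT => normalize g 0 i) =
    (fun g => (\sum_(j < n) tnth g j ^+ 2) `^ (- 2^-1) * tnth g i).
  apply/funext => g; rewrite /normalize !mxE powRN powR12_sqrt; last first.
    by apply: sumr_ge0 => j _; exact: sqr_ge0.
  by rewrite /l2norm; congr ((Num.sqrt _)^-1 * _); apply: eq_bigr => j _; rewrite mxE.
apply: measurable_funM; last exact: mt.
apply: (measurableT_comp (measurable_powR _)).
by apply: measurable_sum => j; apply: measurable_funX; exact: mt.
Qed.

Lemma normalize_le1 n (g : n.-tuple RT) : l2norm (normalize g) <= 1.
Proof. exact: l2norm_normalize_le1. Qed.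

Lemma normalize_signed_perm n (s : 'I_n -> R) (p : {perm 'I_n}) (g : n.-tuple RT) i :
  (forall j, s j ^+ 2 = 1) -> normalize (signed_perm s p g) 0 i = s i * normalize g 0 (p i).
Proof.
move=> s1; rewrite /normalize !mxE tnth_mktuple.
have -> : l2norm (row_of_tuple (signed_perm s p g)) = l2norm (row_of_tuple g).
  rewrite /l2norm; congr Num.sqrt.
  rewrite [RHS](reindex_inj (@perm_inj _ p)).
  by apply: eq_bigr => j _; rewrite !mxE tnth_mktuple exprMn s1 mul1r.
by rewrite mulrCA.
Qed.

Lemma Rintegral_preserves_gaussian n (h : n.-tuple RT -> n.-tuple RT) (f : n.-tuple RT -> R) :
  preserves_gaussian n h -> measurable_fun setT f ->
  \int[std_gaussian R n]_g f (h g) = \int[std_gaussian R n]_g f g.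
Proof.
move=> hinv mf; have mEf : measurable_fun setT (EFin \o f) by exact/measurable_EFinP.
rewrite /Rintegral; congr fine.
have hp := hinv _ (measurable_funepos mEf) (funepos_ge0 (EFin \o f)).
have hn := hinv _ (measurable_funeneg mEf) (funeneg_ge0 (EFin \o f)).
rewrite (@integralE _ _ _ _ _ (EFin \o f)) (@integralE _ _ _ _ _ (fun g => (f (h g))%:E)).
by rewrite -hp -hn; congr (_ - _)%E; apply: eq_integral => g _; rewrite ?funeposE ?funenegE.
Qed.


(** Integrability and value travel together, so that means of linear combinations need no side
    conditions. *)
Definition has_mean {n} (h : n.-tuple RT -> R) (m : R) :=
  (std_gaussian R n).-integrable setT (EFin \o h) /\
  \int[std_gaussian R n]_g h g = m.

Lemma has_meanD n (h1 h2 : n.-tuple RT -> R) m1 m2 :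
  has_mean h1 m1 -> has_mean h2 m2 -> has_mean (fun g => h1 g + h2 g) (m1 + m2).
Proof.
move=> [i1 <-] [i2 <-]; split; last by rewrite RintegralD.
exact: (integrableD measurableT i1 i2).
Qed.

Lemma has_meanZ n (h : n.-tuple RT -> R) m c :
  has_mean h m -> has_mean (fun g => c * h g) (c * m).
Proof.
move=> [i <-]; split; last by rewrite RintegralZl.
exact: (integrableZl measurableT c i).
Qed.

Lemma has_mean_cst n (c : R) : @has_mean n (fun=> c) c.
Proof.
split; first exact: finite_measure_integrable_cst.
by rewrite Rintegral_cst//= probability_setT mulr1.
Qed.

Lemma has_mean_sum n (I : finType) (h : I -> n.-tuple RT -> R) (m : I -> R) :
  (forall i, has_mean (h i) (m i)) ->
  has_mean (fun g => \sum_i h i g) (\sum_i m i).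
Proof.
move=> hm; elim: index_enum => [|i s IH].
  rewrite big_nil (_ : (fun=> _) = (fun=> 0)); first exact: has_mean_cst.
  by apply/funext => g; rewrite big_nil.
rewrite big_cons (_ : (fun=> _) = (fun g => h i g + \sum_(i <- s) h i g)).
  exact: has_meanD.
by apply/funext => g; rewrite big_cons.
Qed.

Lemma bounded_has_mean n (h : n.-tuple RT -> R) (c : R) :
  measurable_fun setT h -> (forall g, `|h g| <= c) ->
  has_mean h (\int[std_gaussian R n]_g h g).
Proof.
move=> mh hc; split=> //; apply: measurable_bounded_integrable => //.
  by rewrite (le_lt_trans (probability_le1 _ _))// ltry.
exists c; split; rewrite ?num_real// => x cx g _ /=.
exact: le_trans (hc g) (ltW cx).
Qed.

Lemma normalize_coord_le1 n (g : n.-tuple RT) i : `|normalize g 0 i| <= 1.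
Proof. exact: le_trans (coord_le_l2norm _ _) (normalize_le1 _ _). Qed.

(** Invariance under the flip makes the integral equal to its opposite. *)
Lemma has_mean_flip n i (h : n.-tuple RT -> R) :
  measurable_fun setT h -> (forall g, `|h g| <= 1) ->
  (forall g, h (signed_perm (flip i) 1%g g) = - h g) -> has_mean h 0.
Proof.
move=> mh h1 hN; have [ih E] := bounded_has_mean _ _ _ mh h1.
split=> //; have := Rintegral_preserves_gaussian _ _ _ (preserves_gaussian_flip _ i) mh.
under eq_Rintegral do rewrite hN -mulN1r.
by rewrite RintegralZl//; lra.
Qed.

Lemma flip_sqr n (i j : 'I_n) : flip i j ^+ 2 = 1 :> R.
Proof. by rewrite /flip; case: ifP; rewrite ?sqrrN expr1n. Qed.

Lemma has_mean_normalize n i : has_mean (fun g : n.-tuple RT => normalize g 0 i) 0.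
Proof.
apply: (has_mean_flip _ i).
- exact: measurable_normalize.
- by move=> g; exact: normalize_coord_le1.
- move=> g; rewrite normalize_signed_perm; last exact: flip_sqr.
  by rewrite perm1 /flip eqxx mulN1r.
Qed.

Lemma has_mean_normalize2_neq n i j : i != j ->
  has_mean (fun g : n.-tuple RT => normalize g 0 i * normalize g 0 j) 0.
Proof.
move=> ij; apply: (has_mean_flip _ i).
- by apply: measurable_funM; exact: measurable_normalize.
- by move=> g; rewrite normrM mulr_ile1// normalize_coord_le1.
- move=> g; rewrite !normalize_signed_perm; [|exact: flip_sqr..].
  by rewrite !perm1 /flip eqxx eq_sym (negbTE ij) mul1r mulN1r mulNr.
Qed.

Lemma measurable_normalize_sqr n i :
  measurable_fun setT (fun g : n.-tuple RT => normalize g 0 i ^+ 2).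
Proof. by apply: measurable_funX; exact: measurable_normalize. Qed.

Lemma normalize_sqr_le1 n (g : n.-tuple RT) i : `|normalize g 0 i ^+ 2| <= 1.
Proof. by rewrite normrX exprn_ile1// normalize_coord_le1. Qed.

(** Each adjacent swap lowers the index by one. *)
Lemma Rintegral_normalize_sqr n (i : 'I_n.+1) :
  \int[std_gaussian R n.+1]_g (normalize g 0 i ^+ 2) =
  \int[std_gaussian R n.+1]_g (normalize g 0 ord0 ^+ 2).
Proof.
case: i => i; elim: i => [|i IH] iP.
  by congr Rintegral; apply/funext => g; congr (normalize g 0 _ ^+ 2); exact: val_inj.
rewrite -(IH (ltnW iP)).
pose a := Ordinal (ltnW iP); pose b := Ordinal iP.
rewrite -(Rintegral_preserves_gaussian _ _ _ (@preserves_gaussian_swap R _ a b erefl)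
  (measurable_normalize_sqr _ a)).
congr Rintegral; apply/funext => g.
rewrite normalize_signed_perm; last by move=> j; rewrite expr1n.
by rewrite mul1r tpermL.
Qed.

Lemma integral_std_gaussian_cst n (c : \bar R) :
  (\int[std_gaussian R n]_(x in setT) (cst c) x = c)%E.
Proof.
have P1 : std_gaussian R n setT = 1%E by exact: probability_setT.
by rewrite integral_cst// [X in (_ * X)%E]P1 mule1.
Qed.

Lemma measurable_head0 n :
  measurable [set g : n.+1.-tuple RT | tnth g ord0 = (0 : R)].
Proof.
have := @measurable_tnth _ RT n.+1 ord0 measurableT [set (0 : R)] (measurable_set1 _).
by rewrite setTI.
Qed.

(** A null set containing the zero tuple, the only place where normalising fails; a single
    coordinate is enough, since its normal law has no atom. *)
Lemma std_gaussian_head0 n :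
  std_gaussian R n.+1 [set g : n.+1.-tuple RT | tnth g ord0 = (0 : R)] = 0%E.
Proof.
set A := (X in std_gaussian R n.+1 X); have mA : measurable A by exact: measurable_head0.
have -> : std_gaussian R n.+1 A = (\int[std_gaussian R n.+1]_g (\1_A g)%:E)%E.
  by rewrite integral_indic// setIT.
rewrite (ge0_integral_std_gaussianS _ (fun g => (\1_A g)%:E)); first last.
- by move=> g; rewrite lee_fin.
- by apply/measurable_EFinP; exact: measurable_indic.
transitivity (\int[normal_prob 0 1]_a (\1_[set (0 : R)] a)%:E)%E.
  apply: eq_integral => a _.
  transitivity (\int[std_gaussian R n]_(x in setT) (cst (\1_[set (0:R)] a)%:E) x)%E.
    by apply: eq_integral => t _ /=; rewrite !indicE; congr (_ %:R%:E); apply/idP/idP; rewrite !inE.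
  exact: integral_std_gaussian_cst.
by rewrite integral_indic// setIT; exact: normal_prob_set1.
Qed.

(** The squared coordinates have a common mean and sum to 1 almost everywhere. *)
Lemma has_mean_normalize2 n i :
  has_mean (fun g : n.+1.-tuple RT => normalize g 0 i ^+ 2) n.+1%:R^-1.
Proof.
have mean0 j := bounded_has_mean _ _ _ (measurable_normalize_sqr n.+1 j)
  (fun g => normalize_sqr_le1 _ g j).
have [int0 _] := mean0 i.
split=> //; rewrite Rintegral_normalize_sqr.
set I := Rintegral _ _ _.
have [_] := has_mean_sum _ _ _ _ mean0.
under [in RHS]eq_bigr do rewrite Rintegral_normalize_sqr.
rewrite sumr_const card_ord -/I => sumE.
suff sum1 : n.+1%:R * I = 1 by rewrite -[LHS](mulKf (x := n.+1%:R)) ?sum1 ?mulr1// pnatr_eq0.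
rewrite mulr_natl -sumE -[RHS]/(fine 1%E) /Rintegral; congr fine.
transitivity (\int[std_gaussian R n.+1]_(x in setT) (cst 1%E) x)%E; last first.
  by rewrite integral_std_gaussian_cst.
apply: ae_eq_integral => //.
  apply/measurable_EFinP; apply: measurable_sum => j; exact: measurable_normalize_sqr.
exists [set g : n.+1.-tuple RT | tnth g ord0 = (0 : R)]; split.
- exact: measurable_head0.
- exact: std_gaussian_head0.
move=> g /=; apply: contra_notP => g0 _; congr EFin.
rewrite -l2normE l2norm_normalize ?expr1n//.
by apply: contra_notN g0 => /eqP/rowP/(_ ord0); rewrite !mxE.
Qed.

End unit_gaussian.

(** * Local bounds on the sharpness of one loss *)

Section average_sharpness.
Context {R : realType} {D : nat}.
Implicit Types (F : 'rV[R]_D -> R) (x v : 'rV[R]_D).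

(** The polynomial is integrated exactly: linear and mixed terms have mean 0, each square has mean
    [1/D]. The error [e] survives because the measure has mass 1. It serves both for the Taylor
    polynomial and, with [a] and [q] zero, for a mere continuity estimate. *)
Lemma sharp_avg_approx F (rho : R) x (a : 'rV[R]_D) (q : 'I_D -> 'I_D -> R) (e : R) :
  (0 < D)%N -> continuous F ->
  (forall v, l2norm v <= 1 ->
    `|F (x + rho *: v) - F x - dot a v - \sum_i \sum_j q i j * v 0 i * v 0 j| <= e) ->
  exists2 s, sharp_avg F rho x = s%:E & `|s - (\sum_i q i i) / D%:R| <= e.
Proof.
case: D F x a q => // n F x a q _ cF approx.
pose u (g : n.+1.-tuple (measurableTypeR R)) := normalize g.
pose G g := F (x + rho *: u g).
pose Q g := \sum_i \sum_j q i j * (u g 0 i * u g 0 j).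
pose P g := F x + (\sum_i a 0 i * u g 0 i + Q g).
have mG : measurable_fun setT G.
  apply: (@measurable_continuous_rV R _ _ _ (fun g => x + rho *: u g) F) => // i.
  rewrite (_ : (fun t => _) = (fun g => x 0 i + rho * u g 0 i)); last first.
    by apply/funext => g; rewrite !mxE.
  apply: measurable_funD => //; apply: measurable_funM => //.
  exact: measurable_normalize.
have GP g : `|G g - P g| <= e.
  have := approx (u g) (normalize_le1 _ g); congr (`|_| <= e).
  rewrite /G /P /dot /Q.
  have -> : \sum_i \sum_j q i j * u g 0 i * u g 0 j = \sum_i \sum_j q i j * (u g 0 i * u g 0 j).
    by apply: eq_bigr => i _; apply: eq_bigr => j _; rewrite mulrA.
  ring.
have meanP : has_mean P (F x + (\sum_i a 0 i * 0 +
    \sum_i \sum_j q i j * ((i == j)%:R / n.+1%:R))).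
  apply: (has_meanD _ (fun=> F x) (fun g => \sum_i a 0 i * u g 0 i + Q g)).
    exact: has_mean_cst.
  apply: (has_meanD _ (fun g => \sum_i a 0 i * u g 0 i) Q).
    by apply: has_mean_sum => i; apply: has_meanZ; exact: has_mean_normalize.
  apply: has_mean_sum => i; apply: has_mean_sum => j; apply: has_meanZ.
  have [<-|ij] := eqVneq i j.
    by rewrite mul1r; under eq_fun do rewrite -expr2; exact: has_mean_normalize2.
  by rewrite mul0r; exact: has_mean_normalize2_neq.
have diagE : F x + (\sum_i a 0 i * 0 + \sum_i \sum_j q i j * ((i == j)%:R / n.+1%:R))
    = F x + (\sum_i q i i) / n.+1%:R.
  congr (_ + _); rewrite big1 ?add0r => [|i _]; last by rewrite mulr0.
  rewrite mulr_suml; apply: eq_bigr => i _.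
  rewrite (bigD1 i)//= eqxx mul1r big1 ?addr0// => j ij.
  by rewrite eq_sym (negbTE ij) mul0r mulr0.
rewrite {}diagE in meanP.
have mP : measurable_fun setT P.
  by have [/integrableP[/measurable_EFinP]] := meanP.
(* [G] is integrable as the sum of the bounded [G - P] and the integrable [P]. *)
have [iGP _] := bounded_has_mean _ (fun g => G g - P g) e (measurable_funB mG mP) GP.
have [iP EP] := meanP.
have [+ _] := has_meanD _ _ _ _ _ (conj iGP erefl) meanP.
rewrite (_ : (fun g => G g - P g + P g) = G); last by apply/funext => g; rewrite subrK.
move=> iG.
exists (\int[std_gaussian R n.+1]_g G g - F x).
  rewrite /sharp_avg EFinB; congr (_ - _)%E.
  rewrite /Rintegral fineK//; exact: integrable_fin_num.
have -> : \int[std_gaussian R n.+1]_g G g - F x - (\sum_i q i i) / n.+1%:R =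
    \int[std_gaussian R n.+1]_g (G g - P g).
  by rewrite RintegralB// EP; ring.
apply: (le_trans (le_normr_Rintegral _ iGP)) => //.
have <- : \int[std_gaussian R n.+1]_g (cst e g) = e.
  by have [_] := @has_mean_cst R n.+1 e.
apply: le_Rintegral => //.
- exact: integrable_norm.
- exact: (@has_mean_cst R n.+1 e).1.
Qed.

End average_sharpness.

Section dot_inequality.
Context {R : realType} {D : nat}.
Implicit Types v w : 'rV[R]_D.

Lemma dotDr v w1 w2 : dot v (w1 + w2) = dot v w1 + dot v w2.
Proof. by rewrite /dot -big_split; apply: eq_bigr => i _; rewrite mxE mulrDr. Qed.

Lemma dotDl v1 v2 w : dot (v1 + v2) w = dot v1 w + dot v2 w.
Proof. by rewrite dotC dotDr !(dotC w). Qed.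

Lemma dot_CauchySchwarz v w : dot v w ^+ 2 <= l2norm v ^+ 2 * l2norm w ^+ 2.
Proof.
have [->|v0] := eqVneq v 0.
  rewrite /dot big1 ?expr0n/= => [|i _]; last by rewrite mxE mul0r.
  by rewrite mulr_ge0 ?sqr_ge0.
have n0 : 0 < l2norm v ^+ 2 by rewrite exprn_gt0 ?l2norm_gt0.
rewrite -subr_ge0 -(pmulr_rge0 _ n0).
(* This square equals [|v|^2 * (|v|^2 * |w|^2 - (dot v w)^2)]. *)
have : 0 <= dot (l2norm v ^+ 2 *: w + (- dot v w) *: v) (l2norm v ^+ 2 *: w + (- dot v w) *: v).
  by rewrite dotvv sqr_ge0.
rewrite dotDl !dotDr !dotZl !dotZr (dotC w v) !dotvv.
by congr (0 <= _); ring.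
Qed.

Lemma dot_le_l2norm v w : l2norm w <= 1 -> `|dot v w| <= l2norm v.
Proof.
move=> w1; rewrite -ler_sqr ?nnegrE ?l2norm_ge0// real_normK ?num_real//.
apply: (le_trans (dot_CauchySchwarz _ _)).
by rewrite ler_piMr ?sqr_ge0// exprn_ile1// l2norm_ge0.
Qed.

End dot_inequality.

Section local_bounds.
Context {R : realType} {D : nat}.
Implicit Types (F : 'rV[R]_D -> R) (x v : 'rV[R]_D).
Local Open Scope ereal_scope.

(** Lets Asc inherit its upper bound from Max. *)
Lemma sharp_asc_le_max F (rho : R) x : grad F x != 0%R ->
  sharp_asc F rho x <= sharp_max F rho x.
Proof.
move=> g0; rewrite /sharp_asc (negbTE g0); apply: ereal_sup_ubound.
by exists ((l2norm (grad F x))^-1 *: grad F x)%R => //=; exact: l2norm_normalize_le1.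
Qed.

Lemma sharp_max_ge F (rho : R) x v : (l2norm v <= 1)%R ->
  (F (x + rho *: v)%R - F x)%:E <= sharp_max F rho x.
Proof. by move=> v1; apply: ereal_sup_ubound; exists v. Qed.

(** Used where the loss is above its minimum: continuity alone keeps the sharpness from offsetting
    that gap. *)
Lemma sharp_lower_weak t F x (d : R) : (0 < D)%N -> continuous F -> (0 < d)%R ->
  \forall x' \near x & rho \near 0^'+, (- d)%:E <= sharp t F rho x'.
Proof.
move=> D0 cF d0.
have near_F : \forall z \near x, (`|F z - F x| <= d / 2)%R.
  have := cF x; move/(@cvgrPdist_le _ _ _ (nbhs x)) => /(_ (d / 2) (divr_gt0 d0 (ltr0Sn _ 1)))%R.
  by apply: filterS => z; rewrite distrC.
have := near_translate x _ near_F; near_simpl; apply: filter_app.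
near=> x' rho => /= FF.
have rho0 : (0 < rho)%R by near: rho; exact: nbhs_right_gt.
have Fd v : (l2norm v <= 1)%R -> (`|F (x' + rho *: v) - F x'| <= d)%R.
  move=> v1; have := FF v rho v1 (ltW rho0) (lexx _).
  have := FF 0%R 0%R; rewrite l2norm0 scale0r addr0 => /(_ ler01 (lexx _) (ltW rho0)).
  by rewrite !ler_norml => /andP[? ?] /andP[? ?]; apply/andP; split; lra.
case: t => /=.
- apply: (le_trans _ (sharp_max_ge _ _ _ 0%R _)); last by rewrite l2norm0 ler01.
  by rewrite scaler0 addr0 subrr lee_fin; lra.
- rewrite /sharp_asc; case: ifPn => [_|g0]; first exact: leey.
  rewrite lee_fin; have := Fd _ (l2norm_normalize_le1 (grad F x')).
  by rewrite ler_norml => /andP[].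
- have [|s -> ] := sharp_avg_approx F rho x' 0%R (fun _ _ => 0%R) d D0 cF.
    move=> v v1; rewrite (_ : _ - _ - _ = F (x' + rho *: v) - F x')%R; first exact: Fd.
    rewrite /dot !big1 ?subr0// => i _; last by rewrite mxE mul0r.
    by rewrite big1// => j _; rewrite !mul0r.
  rewrite big1// mul0r subr0 lee_fin ler_norml => /andP[]//.
Unshelve. all: by end_near. Qed.

End local_bounds.

(** The factor in front of the trace: [1/2] from Taylor's formula, and for Avg a further [1/D] from
    the second moments on the sphere. *)
Definition sharp_coef {R : realType} (D : nat) (t : sharpness) : R :=
  if t is Avg then (2 * D%:R)^-1 else 2^-1.

Section zero_loss.
Context {R : realType} {D : nat}.
Variables (g : R^o -> R) (f : 'rV[R]_D -> R).
Hypotheses (g2 : Cn 2 g) (f2 : Cn 2 f) (D0 : (0 < D)%N).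
Let F x := g (f x).
Variable x : 'rV[R]_D.
Hypotheses (g'0 : 'D_1 g (f x) = 0)
  (g''0 : 0 < 'D_1 (fun a => 'D_1 g a) (f x)) (f'0 : grad f x != 0).
Let c := 'D_1 (fun a => 'D_1 g a) (f x).
Let T := c * l2norm (grad f x) ^+ 2.
Let F2 : Cn 2 F := Cn2_comp g f g2 f2.

Lemma grad_comp z : grad F z = 'D_1 g (f z) *: grad f z.
Proof. by apply/rowP => i; rewrite !mxE (derive_comp g f g2 f2). Qed.

Lemma derive2_zero_loss v w : 'D_w (fun z => 'D_v F z) x =
  c * ('D_w f x * 'D_v f x).
Proof. by rewrite (derive2_comp g f g2 f2) g'0 mul0r addr0 -mulrA. Qed.

Lemma d2_zero_loss v : d2 F x v = c * dot (grad f x) v ^+ 2.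
Proof.
by rewrite -(derive2E _ _ _ F2) derive2_zero_loss -expr2 derive_dot//; exact: f2.1.
Qed.

Lemma trace_zero_loss :
  \sum_i 'D_(delta_mx 0 i) (fun z => 'D_(delta_mx 0 i) F z) x = T.
Proof.
rewrite /T l2normE mulr_sumr; apply: eq_bigr => i _.
by rewrite derive2_zero_loss mxE expr2.
Qed.

Lemma taylor2_zero_loss (d : R) : 0 < d ->
  \forall x' \near x & rho \near 0^'+, forall v, l2norm v <= 1 ->
  `|F (x' + rho *: v) - F x' - rho * dot (grad F x') v
    - rho ^+ 2 / 2 * (c * dot (grad f x) v ^+ 2)| <= d * rho ^+ 2.
Proof.
by move=> d0; have := taylor2 F x d F2 d0; apply: filterS => -[x' rho] /= h v;
  rewrite -d2_zero_loss; exact: h.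
Qed.

Lemma sharp_avg_zero_loss (d : R) : 0 < d ->
  \forall x' \near x & rho \near 0^'+, exists2 s,
    sharp_avg F rho x' = s%:E & `|s - rho ^+ 2 * (sharp_coef D Avg * T)| <= d * rho ^+ 2.
Proof.
move=> d0; have := taylor2 F x d F2 d0; apply: filterS => -[x' rho] /= h.
have := sharp_avg_approx F rho x' (rho *: grad F x')
  (fun i j => rho ^+ 2 / 2 * 'D_(delta_mx 0 j) (fun z => 'D_(delta_mx 0 i) F z) x)
  (d * rho ^+ 2) D0 (Cn_continuous _ _ F2).
case=> [v v1|s -> sE].
  have := h v v1; congr (`|_ - _ - _| <= _); first by rewrite dotZl.
  rewrite /d2 mulr_sumr; apply: eq_bigr => i _; rewrite mulr_sumr.
  by apply: eq_bigr => j _; rewrite !mulrA.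
exists s => //; move: sE; congr (`|_ - _| <= _).
by rewrite -mulr_sumr trace_zero_loss /sharp_coef invfM; ring.
Qed.

Lemma sharp_zero_loss_ge t (d : R) : 0 < d ->
  \forall x' \near x & rho \near 0^'+,
    ((rho ^+ 2 * (sharp_coef D t * T - d))%:E <= sharp t F rho x')%E.
Proof.
move=> d0; have d2 : 0 < d / 2 by rewrite divr_gt0.
have N0 : 0 < l2norm (grad f x) by rewrite l2norm_gt0.
case: t => /=.
- have := taylor2_zero_loss _ d0; apply: filterS => -[x' rho] /= h.
  pose n := (l2norm (grad f x))^-1 *: grad f x.
  have n1 : l2norm n = 1 by exact: l2norm_normalize.
  have nE : dot (grad f x) n ^+ 2 = l2norm (grad f x) ^+ 2.
    by rewrite dotZr dotvv; congr (_ ^+ 2); rewrite expr2 mulKf ?gt_eqF.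
  (* The quadratic term does not see the sign of the direction, so [s] is free to make the linear
     term nonnegative. *)
  pose s : R := if 0 <= rho * dot (grad F x') n then 1 else -1.
  have sn1 : l2norm (s *: n) <= 1.
    by rewrite l2normZ n1 mulr1 /s; case: ifP; rewrite ?normrN normr1.
  apply: le_trans (sharp_max_ge _ _ _ _ sn1); rewrite lee_fin.
  have := h _ sn1; rewrite !(dotZr s) exprMn nE.
  have -> : s ^+ 2 = 1 by rewrite /s; case: ifP; rewrite ?sqrrN expr1n.
  rewrite mul1r -/T ler_norml => /andP[+ _].
  have : 0 <= rho * (s * dot (grad F x') n).
    by rewrite mulrCA /s; case: ifP; lra.
  by rewrite /sharp_coef; lra.
(* The normalised [grad F] has no limit at [x], where the factor ['D_1 g (f z)] vanishes. Up to sign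
   it is the normalised [grad f], and [psi], the quadratic term in that direction, ignores the sign
   and is continuous at [x]. *)
- pose psi z := c * (dot (grad f x) (grad f z) ^+ 2 / dot (grad f z) (grad f z)).
  have psix : psi x = T.
    by rewrite /psi /T dotvv expr2 mulfK// gt_eqF// exprn_gt0.
  have cgrad := grad_continuous f (CnS _ _ f2).
  have cpsi : psi z @[z --> x] --> psi x.
    apply: (@cvgM _ _ (nbhs x) (nbhs_filter x)); first exact: cvg_cst.
    apply: (@cvgM _ _ (nbhs x) (nbhs_filter x)).
      have cd : dot (grad f x) (grad f z) @[z --> x] --> dot (grad f x) (grad f x).
        apply: (@cvg_comp _ _ _ (grad f) (dot (grad f x)) (nbhs x) (nbhs (grad f x))).
          exact: cgrad.
        exact: dot_continuous.
      by apply: (@cvgM _ _ (nbhs x) (nbhs_filter x)).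
    apply: (@cvgV _ _ (nbhs x) (nbhs_filter x)).
      by rewrite dotvv gt_eqF// exprn_gt0.
    apply: (@cvg_sumr _ _ (nbhs x)) => i.
    have ci : grad f z 0 i @[z --> x] --> grad f x 0 i.
      apply: (@cvg_comp _ _ _ (grad f) (fun w => w 0 i) (nbhs x) (nbhs (grad f x))).
        exact: cgrad.
      exact: coord_continuous.
    exact: (@cvgM _ _ (nbhs x) (nbhs_filter x)).
  have near_psi : \forall z \near x, T - d <= psi z.
    move/(@cvgrPdist_le _ _ _ (nbhs x)) : cpsi => /(_ d d0); apply: filterS => z.
    by rewrite psix ler_norml => /andP[_]; lra.
  have := taylor2_zero_loss _ d2; near_simpl; apply: filter_app.
  near=> x' rho => /= h.
  have rho0 : 0 < rho by near: rho; exact: nbhs_right_gt.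
  have psix' : T - d <= psi x' by near: x'.
  (* At a zero gradient the value [+oo] makes the lower bound free; only the upper bound has to
     avoid such points. *)
  rewrite /sharp_asc; case: ifPn => [_|G0]; first exact: leey.
  rewrite lee_fin; have := h _ (l2norm_normalize_le1 (grad F x')).
  set n := _^-1 *: _.
  have a0 : 'D_1 g (f x') != 0 by apply: contra_neq G0; rewrite grad_comp => ->; rewrite scale0r.
  have h0 : grad f x' != 0 by apply: contra_neq G0; rewrite grad_comp => ->; rewrite scaler0.
  have hh0 : 0 < l2norm (grad f x') by rewrite l2norm_gt0.
  have -> : c * dot (grad f x) n ^+ 2 = psi x'.
    rewrite /psi dotvv /n grad_comp l2normZ !dotZr; congr (_ * _).
    rewrite !exprMn exprVn exprMn real_normK ?num_real//; field.
    by rewrite a0 gt_eqF.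
  have : 0 <= rho * dot (grad F x') n.
    by rewrite dotZr dotvv expr2 mulrA mulr_ge0 ?(ltW rho0)//
      mulr_ge0 ?l2norm_ge0// mulr_ge0 ?invr_ge0 ?l2norm_ge0.
  rewrite ler_norml => f0 /andP[+ _].
  have : rho ^+ 2 * (T - d) <= rho ^+ 2 * psi x' by rewrite ler_pM2l// exprn_gt0.
  by rewrite /sharp_coef; lra.
- have := sharp_avg_zero_loss _ d0; apply: filterS => -[x' rho] /= [s -> sE].
  by rewrite lee_fin; move: sE; rewrite ler_norml => /andP[+ _]; lra.
Unshelve. all: by end_near. Qed.

(** [rho] is fixed before [x']: the linear term is at most [rho * l2norm (grad F x')], and this is
    below [d / 2 * rho ^+ 2] only on a neighbourhood that shrinks with [rho]. Cauchy-Schwarz bounds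
    the quadratic term. *)
Lemma sharp_max_zero_loss_le (d : R) : 0 < d ->
  \forall rho \near 0^'+, \forall x' \near x,
    (sharp_max F rho x' <= (rho ^+ 2 * (sharp_coef D Max * T + d))%:E)%E.
Proof.
move=> d0; have d2 : 0 < d / 2 by rewrite divr_gt0.
have [[A B] [/= nA nB] AB] := taylor2_zero_loss _ d2.
near=> rho.
have rho0 : 0 < rho by near: rho; exact: nbhs_right_gt.
have Brho : B rho by near: rho.
have near_grad : \forall z \near x, l2norm (grad F z) <= d / 2 * rho.
  have cF := grad_continuous F (CnS _ _ F2) x.
  have nG : \forall z \near x, l2norm (grad F z - grad F x) <= d / 2 * rho.
    exact: cF _ (l2ball_near (grad F x) (d / 2 * rho) (mulr_gt0 d2 rho0)).
  by apply: filterS nG => z; rewrite [grad F x]grad_comp g'0 scale0r subr0.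
near=> x'.
have Ax' : A x' by near: x'.
have gx' : l2norm (grad F x') <= d / 2 * rho by near: x'.
apply: ge_ereal_sup => _ [v /= v1 <-]; rewrite lee_fin.
have /= := AB (x', rho) (conj Ax' Brho) _ v1; rewrite ler_norml => /andP[_].
have : rho * dot (grad F x') v <= rho * (d / 2 * rho).
  rewrite ler_pM2l//; apply: (le_trans (ler_norm _)).
  exact: le_trans (dot_le_l2norm _ _ v1) gx'.
have : rho ^+ 2 * (c * dot (grad f x) v ^+ 2) <= rho ^+ 2 * T.
  rewrite ler_pM2l ?exprn_gt0// ler_pM2l//.
  apply: (le_trans (dot_CauchySchwarz _ _)).
  by rewrite ler_piMr ?sqr_ge0// exprn_ile1// l2norm_ge0.
by rewrite /sharp_coef; lra.
Unshelve. all: by end_near. Qed.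

Lemma sharp_avg_zero_loss_le (d : R) : 0 < d ->
  \forall rho \near 0^'+,
    (sharp_avg F rho x <= (rho ^+ 2 * (sharp_coef D Avg * T + d))%:E)%E.
Proof.
move=> d0; have [[A B] [/= nA nB] AB] := sharp_avg_zero_loss _ d0.
near=> rho; have Brho : B rho by near: rho.
have [s -> +] := AB (x, rho) (conj (nbhs_singleton nA) Brho).
rewrite lee_fin ler_norml => /andP[_].
by rewrite lerBlDr => /le_trans; apply; rewrite mulrDr addrC (mulrC d).
Unshelve. all: by end_near. Qed.

End zero_loss.

(** * Gradient flow started at a minimiser *)

Section gradient_flow_at_minimum.
Context {R : realType} {D : nat}.
Variables (F : 'rV[R]_D -> R) (x : 'rV[R]_D) (phi : R -> 'rV[R]_D).
Hypotheses (F1 : Cn 1 F) (flow : gradient_flow F x phi).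

Let h (j : 'I_D) (t : R) : R := grad F (phi t) 0 j.

Let flow_cont : {within `[0, +oo[, continuous phi}.
Proof. exact: flow.1. Qed.

Let h_cont j : {within `[0, +oo[, continuous (h j)}.
Proof.
move=> t; have cg : {for phi t, continuous (fun z => grad F z 0 j)}.
  apply: (@continuous_comp _ _ _ (grad F) (fun w : 'rV[R]_D => w 0 j)).
    exact: grad_continuous.
  exact: coord_continuous.
exact: (@continuous_comp (subspace _) _ _ phi (fun z => grad F z 0 j) t (flow_cont t) cg).
Qed.

(** The integrand is known to be continuous only on [[0, +oo[], hence the restriction to [t > 0];
    [t + 1] below merely leaves room to the right of [t]. *)
Let is_derive_h (j : 'I_D) (t : R) : 0 < t ->
  is_derive t (1 : R) (fun tau => \int[lebesgue_measure]_(s in `[0, tau]) h j s) (h j t).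
Proof.
move=> t0.
have h_cont0 : {within `[0, t + 1], continuous (h j)}.
  apply: continuous_subspaceW (@h_cont j) => s /=.
  by rewrite !in_itv/= => /andP[->].
have t1 : t < t + 1 by rewrite ltrDl.
have inth : lebesgue_measure.-integrable `[0, t + 1] (EFin \o h j).
  by apply: continuous_compact_integrable => //; exact: segment_compact.
have ht : {for t, continuous (h j)}.
  have t01 : 0 < t + 1 by rewrite (lt_trans t0).
  have [+ _ _] := (continuous_within_itvP (h j) t01).1 h_cont0.
  by apply; rewrite in_itv/= t0.
have [d dE] := continuous_FTC1_closed t1 inth t0 ht.
by apply: DeriveDef => //; rewrite -derive1E.
Qed.

Lemma is_derive_flow (t : R) : 0 < t ->
  derivable phi t (1 : R) /\ 'D_1 phi t = - grad F (phi t).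
Proof.
move=> t0.
pose psi tau := x - \row_j \int[lebesgue_measure]_(s in `[0, tau]) h j s.
have phipsi : \near t, phi t = psi t.
  near=> s; apply: flow.2; apply: ltW; near: s; exact: lt_nbhsr.
have dpsi : derivable psi t (1 : R).
  apply/derivable_mxP => i j; rewrite (_ : (fun _ => _) =
      (fun tau => x i j - \int[lebesgue_measure]_(s in `[0, tau]) h j s)); last first.
    by apply/funext => s; rewrite !mxE.
  apply: derivableB => //.
  by have [] := is_derive_h j _ t0.
split.
  by apply: (@near_eq_derivable _ _ _ psi) => //; apply: filterS phipsi => s ->.
rewrite (@near_eq_derive _ _ _ _ _ _ _ phipsi) derive_mx//; apply/rowP => j.
rewrite mxE (_ : (fun _ => _) =
      (fun tau => x 0 j - \int[lebesgue_measure]_(s in `[0, tau]) h j s)); last first.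
  by apply/funext => s; rewrite !mxE.
have [d dE] := is_derive_h j _ t0.
by rewrite deriveB// derive_cst sub0r dE mxE.
Unshelve. all: by end_near. Qed.

Lemma is_derive_loss_flow (t : R) : 0 < t ->
  derivable (F \o phi) t (1 : R) /\ 'D_1 (F \o phi) t = - l2norm (grad F (phi t)) ^+ 2.
Proof.
move=> t0; have [dphi dphiE] := is_derive_flow _ t0.
have phi_diff : differentiable phi t by apply/derivable1_diffP.
have F_diff : differentiable F (phi t) := F1.1 _.
have c_diff : differentiable (F \o phi) t by exact: differentiable_comp.
split; first exact: diff_derivable.
rewrite deriveE// diff_comp//= -(@deriveE _ _ _ phi t 1 phi_diff) dphiE.
rewrite -deriveE// derive_dot// -dotvv.
by rewrite -scaleN1r dotZr mulN1r.
Qed.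

(** An energy argument: [F] is nonincreasing along the flow and starts at its minimum, so it is
    constant; its derivative, minus the squared gradient norm, is then 0, and the integral defining
    [phi] vanishes. *)
Lemma flow_at_minimum tau : (forall z, F x <= F z) -> grad F x = 0 ->
  0 <= tau -> phi tau = x.
Proof.
move=> Fmin gx0 tau0.
have phi0 : phi 0 = x.
  rewrite flow.2//; apply/rowP => j; rewrite !mxE.
  by rewrite set_itv1 Rintegral_set1 subr0.
have Fphi_cont : {within `[0, +oo[, continuous (F \o phi)}.
  move=> t; exact: (@continuous_comp (subspace _) _ _ phi F t (flow_cont t)
    (Cn_continuous _ _ F1 _)).
have Fphi t : 0 <= t -> F (phi t) = F x.
  move=> t0; apply/eqP; rewrite eq_le Fmin andbT -[in leRHS]phi0.
  apply: (@ler0_derive1_nincry R (F \o phi) 0) => // s; rewrite in_itv/= andbT => s0.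
    exact: (is_derive_loss_flow _ s0).1.
  by rewrite derive1E (is_derive_loss_flow _ s0).2 oppr_le0 sqr_ge0.
have grad0 t : 0 < t -> grad F (phi t) = 0.
  move=> t0; apply/eqP; rewrite -l2norm_eq0 -sqrf_eq0 -oppr_eq0.
  rewrite -(is_derive_loss_flow _ t0).2.
  rewrite (@near_eq_derive _ _ _ _ (cst (F x))); first by rewrite derive_cst.
  near=> s; rewrite /= Fphi//; apply: ltW; near: s; exact: lt_nbhsr.
rewrite flow.2//; apply/rowP => j; rewrite !mxE.
rewrite (@eq_Rintegral _ _ _ _ _ (cst 0)) ?Rintegral_cst ?mul0r ?subr0// => s.
rewrite inE/= in_itv/= => /andP[s0 _].
(* The derivative is known only at positive times; time 0 uses the vanishing gradient at [x]. *)
move: s0; rewrite le_eqVlt => /predU1P[<-|s0]; first by rewrite phi0 gx0 mxE.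
by rewrite grad0// mxE.
Unshelve. all: by end_near. Qed.

End gradient_flow_at_minimum.

Lemma attraction_set_minimum {R : realType} {D : nat} (F : 'rV[R]_D -> R)
    (G : set 'rV[R]_D) (x : 'rV[R]_D) :
  Cn 1 F -> (forall z, F x <= F z) -> grad F x = 0 ->
  attraction_set F G x -> G x.
Proof.
move=> F1 Fmin gx0 [phi [flow [p Gp phip]]].
have phix : phi tau @[tau --> +oo] --> x.
  apply: cvg_near_cst.
  have := @nbhs_pinfty_ge R 0 (num_real _); apply: filterS => tau tau0.
  exact: (flow_at_minimum F x phi F1 flow tau Fmin gx0 tau0).
by rewrite (cvg_unique _ phix phip).
Qed.

(** * From local bounds to limits and near-minimisers *)

(** [omega rho] is the infimum of the admissible [d], plus [rho]: the summand makes it positive, and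
    admissible even when the infimum is not attained. *)
Lemma exists_vanishing_rate {R : realType} (P : R -> R -> Prop) :
  (forall rho d1 d2, d1 <= d2 -> P rho d1 -> P rho d2) ->
  (forall d, 0 < d -> \forall rho \near 0^'+, P rho d) ->
  exists omega : R -> R, [/\ forall rho, 0 < rho -> 0 < omega rho,
    omega rho @[rho --> 0^'+] --> 0 & \forall rho \near 0^'+, P rho (omega rho)].
Proof.
move=> Pmono Pnear.
pose A rho := [set d : R | 0 < d /\ P rho d].
have A0 rho : has_lbound (A rho) by exists 0 => d [/ltW].
have infA0 rho : 0 <= inf (A rho).
  (* By the convention [inf set0 = 0], the rate is positive also where no [d] is admissible. *)
  have [->|/set0P[d Ad]] := eqVneq (A rho) set0; first by rewrite inf0.
  by apply: lb_le_inf; [exists d|move=> e [/ltW]].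
exists (fun rho => inf (A rho) + rho); split.
- by move=> rho rho0; rewrite ltr_wpDl.
- apply/cvgrPdist_le => /= e e0; near=> rho.
  have rho0 : 0 < rho by near: rho; exact: nbhs_right_gt.
  rewrite sub0r normrN ger0_norm ?addr_ge0 ?(ltW rho0)// (splitr e) lerD//.
    apply: ge_inf => //; split; first by rewrite divr_gt0.
    by near: rho; apply: Pnear; rewrite divr_gt0.
  by near: rho; apply: nbhs_right_le; rewrite divr_gt0.
- near=> rho; have rho0 : 0 < rho by near: rho; exact: nbhs_right_gt.
  have [d [d0 Pd] dlt] : exists2 d, A rho d & d < inf (A rho) + rho.
    apply: inf_adherent => //; split=> //; exists 1; split => //.
    by near: rho; exact: Pnear.
  exact: Pmono (ltW dlt) Pd.
Unshelve. all: by end_near. Qed.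

Section sharpness_limit.
Context {R : realType} {D : nat}.
Variables (G : set 'rV[R]_D) (Rf : R -> 'rV[R]_D -> \bar R) (S : 'rV[R]_D -> R).
Hypothesis Rf_ge : forall x (d : R), G x -> 0 < d ->
  \forall x' \near x & rho \near 0^'+, ((rho ^+ 2 * (S x - d))%:E <= Rf rho x')%E.
Hypothesis Rf_le : forall x (d : R), G x -> 0 < d ->
  \forall rho \near 0^'+, forall N, nbhs x N ->
    exists2 x', N x' & (Rf rho x' <= (rho ^+ 2 * (S x + d))%:E)%E.

(** The infimum over the ball grows as [r] decreases, so the inner limit exists as the supremum
    [h rho] over [r > 0]; [Rf_ge] and [Rf_le] trap it within [d] of [S x]. *)
Lemma limiting_regularizer_of_bounds : limiting_regularizer G Rf S.
Proof.
move=> x Gx.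
pose g rho (r : R) := ereal_inf [set (Rf rho x' * ((rho ^+ 2)^-1)%:E)%E
                | x' in [set x' | l2norm (x' - x) <= r]%R].
pose h rho := ereal_sup (g rho @` [set` `]0, +oo[ ]).
have h_near (d : R) : 0 < d -> \forall rho \near 0^'+,
    ((S x - d)%:E <= h rho <= (S x + d)%:E)%E.
  move=> d0; have [[A B] [/= nA nB] AB] := Rf_ge _ _ Gx d0.
  near=> rho; have rho0 : 0 < rho by near: rho; exact: nbhs_right_gt.
  have rho2 : 0 < (rho ^+ 2)^-1 by rewrite invr_gt0 exprn_gt0.
  have rhoK a : a%:E = ((rho ^+ 2 * a)%:E * ((rho ^+ 2)^-1)%:E)%E.
    by rewrite -EFinM mulrC mulKf// gt_eqF// exprn_gt0.
  have mulle a b : (a <= b -> a * ((rho ^+ 2)^-1)%:E <= b * ((rho ^+ 2)^-1)%:E)%E.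
    by apply: (@lee_wpmul2r R); rewrite lee_fin ltW.
  have Brho : B rho by near: rho.
  apply/andP; split.
    have [r r0 rA] := near_l2ball _ _ nA.
    apply: (@le_trans _ _ (g rho r)); last first.
      by apply: ereal_sup_ubound; exists r => //=; rewrite in_itv/= r0.
    apply: le_ereal_inf_tmp => _ [x' /= x'r <-]; rewrite (rhoK (S x - d)).
    apply: mulle; exact: (AB (x', rho) (conj (rA _ x'r) Brho)).
  apply: ge_ereal_sup => _ [r /= + <-]; rewrite in_itv/= andbT => r0.
  have Rf_le_rho : forall N, nbhs x N ->
    exists2 x', N x' & (Rf rho x' <= (rho ^+ 2 * (S x + d))%:E)%E.
    by near: rho; exact: Rf_le.
  have [x' x'r Rx'] := Rf_le_rho _ (l2ball_near x r r0).
  apply: (@le_trans _ _ (Rf rho x' * ((rho ^+ 2)^-1)%:E)%E).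
    by apply: ereal_inf_lbound; exists x'.
  by rewrite (rhoK (S x + d)); exact: mulle.
exists h.
  move=> rho rho0; apply: (@nonincreasing_at_right_cvge R (g rho) 0 +oo%O) => //.
  move=> r1 r2 _ _ r12; apply: le_ereal_inf_tmp => _ [x' /= x'r <-].
  by apply: ereal_inf_lbound; exists x' => //=; exact: le_trans r12.
apply/fine_cvgP; split.
  have := h_near 1 ltr01; apply: filterS => rho /andP[h1 h2].
  by rewrite fin_real// (lt_le_trans _ h1) ?ltNyr// (le_lt_trans h2)// ltry.
apply/cvgrPdist_le => /= e e0; have := h_near e e0; apply: filterS => rho.
case: (h rho) => [r| |]/=; rewrite ?leye_eq ?leeNy_eq ?andbF//.
by rewrite !lee_fin => /andP[? ?]; rewrite ler_norml; apply/andP; split; lra.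
Unshelve. all: by end_near. Qed.

Variables (L : 'rV[R]_D -> R) (Lmin : R).
Hypotheses (L_cont : continuous L) (S_cont : continuous S).
Hypotheses (L_ge : forall x, Lmin <= L x) (L_G : forall x, G x -> L x = Lmin).
Hypothesis S_ge0 : forall x, G x -> 0 <= S x.
Hypothesis Rf_weak : forall (x : 'rV[R]_D) (d : R), 0 < d ->
  \forall x' \near x & rho \near 0^'+, ((- d)%:E <= Rf rho x')%E.

Variable U : set 'rV[R]_D.
Hypotheses (U_bounded : bounded_set U) (U_open : open U)
  (U_G : closure U `&` G `<=` closure (U `&` G)) (UG0 : U `&` G !=set0)
  (U_min : forall x, closure U x -> L x = Lmin -> G x).

Let I := inf (S @` (U `&` G)).

Let I_lbound : has_lbound (S @` (U `&` G)).
Proof. by exists 0 => _ [x [_ Gx] <-]; exact: S_ge0. Qed.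

Let I_le x : U x -> G x -> I <= S x.
Proof. by move=> Ux Gx; apply: ge_inf => //; exists x. Qed.

Let ereal_inf_S : ereal_inf [set (S x)%:E | x in U `&` G] = I%:E.
Proof.
rewrite -(image_comp S EFin) ereal_inf_EFin//.
by have [x UGx] := UG0; exists (S x); exists x.
Qed.

Let ereal_inf_L : ereal_inf [set (L x)%:E | x in U] = Lmin%:E.
Proof.
apply/eqP; rewrite eq_le; apply/andP; split.
  have [x [Ux Gx]] := UG0; rewrite -(L_G _ Gx).
  by apply: ereal_inf_lbound; exists x.
by apply: le_ereal_inf_tmp => _ [x Ux <-]; rewrite lee_fin.
Qed.

(** Needed for limit points of [G] on the boundary of [U], which [U_G] places in this closure. *)
Let I_le_closure x : closure (U `&` G) x -> I <= S x.
Proof.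
move=> clx; rewrite leNgt; apply/negP => SI.
have : \forall z \near x, S z < I.
  have := S_cont x; move/(@cvgrPdist_lt _ _ _ (nbhs x)) => /(_ (I - S x)).
  rewrite subr_gt0 => /(_ SI); apply: filterS => z.
  by rewrite distrC => /(le_lt_trans (ler_norm _)); lra.
by move=> /clx[z [[Uz Gz] /=]]; rewrite ltNge I_le.
Qed.

(** The test point is chosen near an almost optimal [x] for [S], inside the open set [U]. The three
    thirds of [d] pay for the choice of [x], for [L x'] above [Lmin], and for [Rf_le]. *)
Let inf_penalized_le (d : R) : 0 < d -> \forall rho \near 0^'+,
  (ereal_inf [set (L x)%:E + Rf rho x | x in U] <= (Lmin + rho ^+ 2 * (I + d))%:E)%E.
Proof.
move=> d0; have d3 : 0 < d / 3 by rewrite divr_gt0.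
have [_ [x [Ux Gx] <-] xI] : exists2 s, (S @` (U `&` G)) s & s < I + d / 3.
  apply: inf_adherent => //; split=> //.
  by have [x UGx] := UG0; exists (S x); exists x.
near=> rho; have rho0 : 0 < rho by near: rho; exact: nbhs_right_gt.
have Rf_le_rho : forall N, nbhs x N ->
    exists2 x', N x' & (Rf rho x' <= (rho ^+ 2 * (S x + d / 3))%:E)%E.
  by near: rho; exact: Rf_le.
have rd : 0 < rho ^+ 2 * (d / 3) by rewrite mulr_gt0// exprn_gt0.
have nU : nbhs x U by exact: open_nbhs_nbhs.
have nL : \forall z \near x, L z <= Lmin + rho ^+ 2 * (d / 3).
  have := L_cont x; move/(@cvgrPdist_le _ _ _ (nbhs x)) => /(_ _ rd); apply: filterS => z.
  by rewrite distrC (L_G x Gx) => /(le_trans (ler_norm _)); lra.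
have [x' [Ux' Lx'] Rx'] := Rf_le_rho _ (filterI nU nL).
apply: (@le_trans _ _ ((L x')%:E + Rf rho x')%E).
  by apply: ereal_inf_lbound; exists x'.
have LxE : ((L x')%:E <= (Lmin + rho ^+ 2 * (d / 3))%:E)%E by rewrite lee_fin; exact: Lx'.
apply: (le_trans (leeD LxE Rx')); rewrite -EFinD lee_fin.
have : rho ^+ 2 * S x <= rho ^+ 2 * (I + d / 3) by rewrite ler_pM2l ?exprn_gt0// ltW.
by lra.
Unshelve. all: by end_near. Qed.

Lemma near_minimizer_bounds (eps : R) : 0 < eps -> forall d, 0 < d ->
  \forall rho \near 0^'+, forall u, U u ->
    ((L u)%:E + Rf rho u <= ereal_inf [set (L x)%:E + Rf rho x | x in U]
                  + (eps * rho ^+ 2)%:E)%E ->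
    ((L u)%:E - ereal_inf [set (L x)%:E | x in U] <=
        (eps * rho ^+ 2 + d * rho ^+ 2)%:E)%E /\
    (`| (S u)%:E - ereal_inf [set (S x)%:E | x in U `&` G] | <= (eps + d)%:E)%E.
Proof.
move=> eps0 d d0; rewrite ereal_inf_L ereal_inf_S.
have d3 : 0 < d / 3 by rewrite divr_gt0.
have cptU : compact (closure U).
  have [M [_ UM]] := U_bounded.
  pose C := [set z : 'rV[R]_D | `|z| <= M + 1].
  have C_closed : closed C.
    apply: (@closed_comp _ _ (fun z : 'rV[R]_D => `|z|) [set r | r <= M + 1]).
      by move=> z _; exact: norm_continuous.
    exact: closed_le.
  have CU : closure U `<=` C.
    rewrite ((closure_id C).1 C_closed); apply: closure_subset => z Uz.
    by apply: (UM (M + 1)) => //; rewrite ltrDl.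
  apply: (subclosed_compact (@closed_closure _ U)) CU.
  apply: bounded_closed_compact => //; exists (M + 1); split; rewrite ?num_real// => N MN z /= Cz.
  exact: le_trans Cz (ltW MN).
(* By compactness it suffices to treat [u] near one point [x] of the closure, jointly with [rho]
   near 0. *)
have key : \forall rho \near 0^'+, closure U `<=`
    (fun u => ((L u)%:E + Rf rho u <= (Lmin + rho ^+ 2 * (I + d / 3 + eps))%:E)%E ->
      L u - Lmin <= rho ^+ 2 * (eps + d) /\ `|S u - I| <= eps + d).
  apply: (compact_near_coveringP (closure U)).1 => // x clx.
  have [Lx|Lx] := eqVneq (L x) Lmin.
    have Gx := U_min _ clx Lx.
    have IS := I_le_closure _ (U_G _ (conj clx Gx)).
    (* The thirds of [d] go to the variation of [S], to [Rf_ge] and to the [d / 3] already present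
       in [key]. *)
    have nS : \forall z \near x, `|S x - S z| <= d / 3.
      by have := S_cont x; move/(@cvgrPdist_le _ _ _ (nbhs x)); exact.
    have := Rf_ge _ _ Gx d3; near_simpl; apply: filter_app.
    near=> u rho => /= Rfu.
    have rho0 : 0 < rho by near: rho; exact: nbhs_right_gt.
    have rho2 : 0 < rho ^+ 2 by rewrite exprn_gt0.
    have Su : `|S x - S u| <= d / 3 by near: u.
    move: Su; rewrite ler_norml => /andP[Su1 Su2].
    move=> /(le_trans (leeD (lexx _) Rfu)); rewrite -EFinD lee_fin => LSu.
    have Lu := L_ge u.
    have rIS : rho ^+ 2 * I <= rho ^+ 2 * S x by rewrite ler_pM2l.
    have rd : 0 <= rho ^+ 2 * d by rewrite mulr_ge0 ?ltW.
    split; first by lra.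
    have : rho ^+ 2 * (S x - d / 3) <= rho ^+ 2 * (I + d / 3 + eps) by lra.
    by rewrite ler_pM2l// => ?; rewrite ler_norml; apply/andP; split; lra.
  (* Variation of [L], negative part of [Rf] and right-hand side cost at most one quarter each, so
     the premise of [key] is contradictory here. *)
  have gap0 : 0 < (L x - Lmin) / 4.
    by rewrite divr_gt0// subr_gt0 lt_def Lx L_ge.
  set gap := (L x - Lmin) / 4 in gap0.
  have nL : \forall z \near x, `|L x - L z| <= gap.
    by have := L_cont x; move/(@cvgrPdist_le _ _ _ (nbhs x)); exact.
  have := Rf_weak x _ gap0; near_simpl; apply: filter_app.
  near=> u rho => /= Rfu.
  have rho_small : rho ^+ 2 * (I + d / 3 + eps) < gap.
    near: rho.
    have : (rho ^+ 2 * (I + d / 3 + eps)) @[rho --> 0^'+] --> (0 ^+ 2 * (I + d / 3 + eps)).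
      apply: cvg_at_right_filter; apply: cvgM; last exact: cvg_cst.
      exact: exprn_continuous.
    rewrite expr0n/= mul0r => /cvgr0_norm_lt/(_ _ gap0); apply: filterS => rho.
    by apply: le_lt_trans; exact: ler_norm.
  have Lu : `|L x - L u| <= gap by near: u.
  move: Lu; rewrite ler_norml => /andP[Lu1 Lu2].
  move=> /(le_trans (leeD (lexx _) Rfu)); rewrite -EFinD lee_fin => LSu.
  have : L x - Lmin = 4 * gap by rewrite /gap; field.
  by move=> ?; exfalso; lra.
have := inf_penalized_le _ d3; near_simpl; apply: filter_app; near=> rho => infle u Uu umin.
have keyrho : closure U `<=`
    (fun u => ((L u)%:E + Rf rho u <= (Lmin + rho ^+ 2 * (I + d / 3 + eps))%:E)%E ->
      L u - Lmin <= rho ^+ 2 * (eps + d) /\ `|S u - I| <= eps + d) by near: rho.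
have [] := keyrho _ (subset_closure Uu).
  apply: (le_trans umin); apply: (le_trans (leeD infle (lexx _))).
  by rewrite -EFinD lee_fin; lra.
move=> Lu Su; rewrite -!EFinB !lee_fin; split=> //.
by apply: (le_trans Lu); lra.
Unshelve. all: by end_near. Qed.

End sharpness_limit.

(** * Interpolation losses *)

Section Cn_linear.
Context {R : realType} {V : normedModType R}.
Implicit Types F G : V -> R.

Lemma CnD n F G : Cn n F -> Cn n G -> Cn n (F + G).
Proof.
elim: n F G => [|n IH] F G.
  by move=> cF cG x; apply: (@cvgD _ _ _ (nbhs x) (nbhs_filter x)); [exact: cF|exact: cG].
move=> [dF DF] [dG DG]; split=> [x|v]; first by apply: differentiableD; [exact: dF|exact: dG].
rewrite (_ : (fun x => 'D_v (F + G) x) = 'D_v F + 'D_v G).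
  by apply: IH; [exact: DF|exact: DG].
by apply/funext => x; rewrite deriveD//; apply: diff_derivable; [exact: dF|exact: dG].
Qed.

Lemma Cn_scale n (a : R) F : Cn n F -> Cn n (a *: F).
Proof.
elim: n F => [|n IH] F.
  move=> cF x; apply: (@cvgM _ _ (nbhs x) (nbhs_filter x) (cst a)); last exact: cF.
  exact: cvg_cst.
move=> [dF DF]; split=> [x|v]; first by apply: differentiableZ; exact: dF.
rewrite (_ : (fun x => 'D_v (a *: F) x) = a *: 'D_v F); first by apply: IH; exact: DF.
by apply/funext => x; rewrite deriveZ//; apply: diff_derivable; exact: dF.
Qed.

Lemma Cn_cst0 n : Cn n (0 : V -> R).
Proof.
elim: n => [|n IH]; first by move=> x; exact: cvg_cst.
split=> [x|v]; first exact: differentiable_cst.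
rewrite (_ : (fun x => 'D_v 0 x) = 0); first exact: IH.
by apply/funext => x; exact: derive_cst.
Qed.

Lemma Cn_sum n m (F : 'I_m -> V -> R) :
  (forall k, Cn n (F k)) -> Cn n (\sum_k F k).
Proof.
move=> CF; elim/big_rec: _ => [|k G _ CG]; first exact: Cn_cst0.
exact: CnD.
Qed.

End Cn_linear.

(** Applied to the directional derivative of each loss along a line through [x], it produces nearby
    points with nonzero gradients. *)
Lemma pos_derive_near_right {R : realType} (h : R -> R) (d : R) :
  h 0 = 0 -> 0 < d -> is_derive 0 (1 : R) h d -> \forall t \near 0^'+, 0 < h t.
Proof.
move=> h0 d0 [dh dE].
have hd : (t^-1 * h t) @[t --> 0^'+] --> d.
  apply: cvg_dnbhs_at_right; move: dh; rewrite /derivable -dE /derive => /cvg_ex[l hl].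
  have -> : lim ((t^-1 *: (h (t *: (1 : R) + 0) - h 0)) @[t --> 0^']) = l by exact: cvg_lim.
  apply: cvg_trans hl; apply: near_eq_cvg; near=> t.
  by rewrite /= h0 subr0 addr0 [t *: 1]mulr1.
have hpos : \forall t \near 0^'+, 0 < t^-1 * h t by exact: (cvgr_gt d hd 0 d0).
apply: filter_app hpos; near=> t.
by rewrite pmulr_rgt0// invr_gt0; near: t; exact: nbhs_right_gt.
Unshelve. all: by end_near. Qed.

Section stoch_sharp_bounds.
Context {R : realType} {D M : nat}.
Variables (Lk : 'I_M -> 'rV[R]_D -> R).
Local Open Scope ereal_scope.

Lemma le_stoch_sharp t (rho : R) x (a : 'I_M -> R) :
  (forall k, (a k)%:E <= sharp t (Lk k) rho x) ->
  ((M%:R^-1 * \sum_k a k)%R)%:E <= stoch_sharp t Lk rho x.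
Proof.
move=> h; rewrite /stoch_sharp EFinM -sumEFin.
by apply: lee_wpmul2l; [rewrite lee_fin|apply: lee_sum => k _; exact: h].
Qed.

Lemma stoch_sharp_le t (rho : R) x (a : 'I_M -> R) :
  (forall k, sharp t (Lk k) rho x <= (a k)%:E) ->
  stoch_sharp t Lk rho x <= ((M%:R^-1 * \sum_k a k)%R)%:E.
Proof.
move=> h; rewrite /stoch_sharp EFinM -sumEFin.
by apply: lee_wpmul2l; [rewrite lee_fin|apply: lee_sum => k _; exact: h].
Qed.

End stoch_sharp_bounds.

Section interpolation.
Context {R : realType} {D M : nat}.
Hypothesis M_gt0 : (0 < M)%N.
Variables (f : 'I_M -> 'rV[R]_D -> R) (y : 'I_M -> R) (ell : R -> R -> R).
Hypothesis f2 : forall k, Cn 2 (f k).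
Hypothesis ell2 : forall b, Cn 2 (fun a : R^o => ell a b).
Hypothesis ell_argmin : forall b, [set a | forall a', ell a b <= ell a' b] = [set b].
Hypothesis ell_curv : forall b, 0 < derive1n 2 (fun a => ell a b) b.
Hypothesis D_gt0 : (0 < D)%N.

Let Lk := loss_k ell f y.
Let L := loss ell f y.
Let Gamma := interp_manifold f y.
Let Lmin := M%:R^-1 * \sum_k ell (y k) (y k).

Let M0 : M%:R != 0 :> R.
Proof. by rewrite pnatr_eq0 -lt0n. Qed.

Lemma ell_min b a : ell b b <= ell a b.
Proof.
by have : [set a | forall a', ell a b <= ell a' b] b by rewrite ell_argmin.
Qed.

Lemma ell_min_uniq b a : ell a b = ell b b -> a = b.
Proof.
move=> ab; have : [set b] a; last by [].
by rewrite -ell_argmin => a' /=; rewrite ab ell_min.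
Qed.

Lemma ell_deriv b : 'D_1 (fun a : R^o => ell a b) b = 0.
Proof.
have [|t _||t _|_ ->//] := @derive1_at_min R (fun a => ell a b) (b - 1) (b + 1) b.
- by lra.
- exact: diff_derivable ((ell2 b).1 t).
- by rewrite in_itv/=; apply/andP; split; lra.
- exact: ell_min.
Qed.

Lemma ell_deriv2 b :
  0 < 'D_1 (fun a : R^o => 'D_1 (fun a : R^o => ell a b) a) b.
Proof.
have := ell_curv b; rewrite /derive1n/= derive1E.
by rewrite (_ : derive1 _ = (fun a : R^o => 'D_1 (fun a : R^o => ell a b) a))//;
  apply/funext => a; rewrite derive1E.
Qed.

Lemma Cn2_loss_k k : Cn 2 (Lk k).
Proof. exact: (Cn2_comp _ _ (ell2 (y k)) (f2 k)). Qed.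

Let lossE : L = M%:R^-1 *: \sum_k Lk k.
Proof. by apply/funext => x; rewrite /L /loss /= fct_sumE. Qed.

Lemma Cn2_loss : Cn 2 L.
Proof. by rewrite lossE; apply/Cn_scale/Cn_sum; exact: Cn2_loss_k. Qed.

Lemma derive_loss x v : 'D_v L x = M%:R^-1 * \sum_k 'D_v (Lk k) x.
Proof.
have dLk k z : derivable (Lk k) z v by apply: diff_derivable; exact: (Cn2_loss_k k).1.
by rewrite lossE deriveZ ?derive_sum//; exact: derivable_sum.
Qed.

Lemma trace_hessian_loss x : \tr (hessian L x) =
  M%:R^-1 * \sum_k \sum_i 'D_(delta_mx 0 i) (fun z => 'D_(delta_mx 0 i) (Lk k) z) x.
Proof.
rewrite (trace_hessian _ _ Cn2_loss) exchange_big/= mulr_sumr.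
apply: eq_bigr => i _; set e := delta_mx 0 i.
have dLk k z : derivable ('D_e (Lk k)) z e.
  by apply: diff_derivable; exact: ((Cn2_loss_k k).2 e).1.
rewrite (_ : (fun z => 'D_e L z) = M%:R^-1 *: \sum_k 'D_e (Lk k)); last first.
  by apply/funext => z; rewrite derive_loss /= fct_sumE.
by rewrite deriveZ ?derive_sum//; exact: derivable_sum.
Qed.

Lemma trace_hessian_loss_continuous : continuous (fun x => \tr (hessian L x)).
Proof.
rewrite (_ : (fun x => _) = (fun x => \sum_i
    'D_(delta_mx 0 i) (fun z => 'D_(delta_mx 0 i) L z) x)); last first.
  by apply/funext => x; rewrite (trace_hessian _ _ Cn2_loss).
by move=> x; apply: (@cvg_sumr _ _ (nbhs x)) => i; exact: ((Cn2_loss.2 _).2 _).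
Qed.

Lemma loss_min x : Lmin <= L x.
Proof.
rewrite ler_pM2l ?invr_gt0 ?ltr0n//; apply: ler_sum => k _; exact: ell_min.
Qed.

Lemma loss_interp x : (forall k, f k x = y k) -> L x = Lmin.
Proof.
by move=> fx; congr (_ * _); apply: eq_bigr => k _; rewrite /loss_k fx.
Qed.

(** Nonnegative excesses with zero sum all vanish, and the minimiser of [ell] in its first argument
    is unique. *)
Lemma loss_min_interp x : L x = Lmin -> forall k, f k x = y k.
Proof.
move=> Lx k; apply: ell_min_uniq; apply/eqP; rewrite -subr_eq0.
have /eqP : \sum_k (Lk k x - ell (y k) (y k)) = 0.
  by apply/eqP; rewrite sumrB subr_eq0; apply/eqP; exact: (mulfI (invr_neq0 M0) Lx).
rewrite psumr_eq0 => [/allP/(_ k)|i _]; last by rewrite subr_ge0 ell_min.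
by rewrite mem_index_enum => /(_ isT).
Qed.

Lemma grad_loss_interp x : (forall k, f k x = y k) -> grad L x = 0.
Proof.
move=> fx; apply/rowP => i; rewrite !mxE derive_loss big1 ?mulr0// => k _.
by rewrite (derive_comp _ _ (ell2 (y k)) (f2 k)) fx ell_deriv mul0r.
Qed.

Lemma minimum_interp_manifold x : attraction_set L Gamma x -> L x = Lmin -> Gamma x.
Proof.
move=> Ux Lx; have fx := loss_min_interp _ Lx.
apply: (attraction_set_minimum L) => //; first exact: CnS Cn2_loss.
  by move=> z; rewrite Lx loss_min.
exact: grad_loss_interp.
Qed.

(** * Stochastic sharpness near an interpolating point *)

Section at_interpolation_point.
Variable x : 'rV[R]_D.
Hypothesis Gx : Gamma x.

(** Linear independence gives the matrix of gradients a right inverse [B], and [w] is the sum of its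
    columns. A single direction must serve all [k], because one infinite Asc term makes the average
    infinite. *)
Lemma interp_dual_vector : exists w, forall k, dot (grad (f k) x) w = 1.
Proof.
have [B AB] := row_freeP Gx.2; exists (\row_j \sum_k B j k) => k.
have := congr1 (fun A : 'M[R]_M => \sum_l A k l) AB; rewrite /= => ABk.
transitivity (\sum_l (1%:M : 'M[R]_M) k l); last first.
  rewrite (bigD1 k)//= mxE eqxx big1 ?addr0// => l lk.
  by rewrite mxE eq_sym (negbTE lk).
rewrite -ABk /dot.
rewrite [RHS](eq_bigr (fun l => \sum_j (\matrix_(k < M) grad (f k) x) k j * B j l)); last first.
  by move=> l _; rewrite mxE.
rewrite exchange_big/=; apply: eq_bigr => j _.
by rewrite !mxE mulr_sumr; apply: eq_bigr => l _; rewrite ?mxE.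
Qed.

Lemma interp_grad_neq0 k : grad (f k) x != 0.
Proof.
have [w /(_ k) w1] := interp_dual_vector; apply/eqP => g0; move: w1.
rewrite g0 /dot big1 => [/eqP|i _]; last by rewrite mxE mul0r.
by rewrite eq_sym oner_eq0.
Qed.

Let ell'0 k : 'D_1 (fun a : R^o => ell a (y k)) (f k x) = 0.
Proof. by rewrite Gx.1 ell_deriv. Qed.

Let ell''0 k : 0 < 'D_1 (fun a => 'D_1 (fun a : R^o => ell a (y k)) a) (f k x).
Proof. by rewrite Gx.1; exact: ell_deriv2. Qed.

Let T k := 'D_1 (fun a => 'D_1 (fun a : R^o => ell a (y k)) a) (f k x) *
  l2norm (grad (f k) x) ^+ 2.

Let traceE : \tr (hessian L x) = M%:R^-1 * \sum_k T k.
Proof.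
rewrite trace_hessian_loss; congr (_ * _); apply: eq_bigr => k _.
exact: (trace_zero_loss _ _ (ell2 (y k)) (f2 k) _ (ell'0 k)).
Qed.

Lemma trace_hessian_interp_ge0 : 0 <= \tr (hessian L x).
Proof.
rewrite traceE mulr_ge0 ?invr_ge0//; apply: sumr_ge0 => k _.
by rewrite mulr_ge0 ?sqr_ge0// ltW.
Qed.

Let averageE (a b d : R) :
  M%:R^-1 * \sum_k (a * (b * T k + d)) = a * (b * \tr (hessian L x) + d).
Proof.
rewrite traceE -mulr_sumr big_split/= -mulr_sumr sumr_const card_ord -mulr_natl.
by field.
Qed.

Lemma stoch_sharp_interp_ge t (d : R) : 0 < d ->
  \forall x' \near x & rho \near 0^'+,
    ((rho ^+ 2 * (sharp_coef D t * \tr (hessian L x) - d))%:E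
      <= stoch_sharp t Lk rho x')%E.
Proof.
move=> d0.
have /filter_forall : forall k, \forall x' \near x & rho \near 0^'+,
    ((rho ^+ 2 * (sharp_coef D t * T k - d))%:E <= sharp t (Lk k) rho x')%E.
  move=> k.
  exact: (sharp_zero_loss_ge _ _ (ell2 (y k)) (f2 k) D_gt0 x (ell'0 k)
    (interp_grad_neq0 k) t d d0).
apply: filterS => -[x' rho] /= h; rewrite -averageE.
exact: le_stoch_sharp.
Qed.

Lemma stoch_sharp_interp_le t (d : R) : 0 < d ->
  \forall rho \near 0^'+, forall N, nbhs x N -> exists2 x', N x' &
    (stoch_sharp t Lk rho x'
      <= (rho ^+ 2 * (sharp_coef D t * \tr (hessian L x) + d))%:E)%E.
Proof.
move=> d0.
have max_le : \forall rho \near 0^'+, \forall x' \near x, forall k,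
    (sharp_max (Lk k) rho x' <= (rho ^+ 2 * (sharp_coef D Max * T k + d))%:E)%E.
  have : \forall rho \near 0^'+, forall k, \forall x' \near x,
    (sharp_max (Lk k) rho x' <= (rho ^+ 2 * (sharp_coef D Max * T k + d))%:E)%E.
    apply: filter_forall => k.
    exact: (sharp_max_zero_loss_le _ _ (ell2 (y k)) (f2 k) x (ell'0 k) (ell''0 k) d d0).
  by apply: filterS => rho /filter_forall.
case: t.
- apply: filterS max_le => rho h N nN; exists x; first exact: nbhs_singleton.
  by rewrite -averageE; apply: stoch_sharp_le; exact: (nbhs_singleton h).
- apply: filterS max_le => rho h N nN.
  have [w w1] := interp_dual_vector.
  have cvgx : (x + t *: w) @[t --> 0^'+] --> x.
    rewrite -[X in _ --> X]addr0 -(scale0r w); apply: cvg_at_right_filter.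
    by apply: cvgD; [exact: cvg_cst|exact: scalel_continuous].
  (* Along [w] the function ['D_w (Lk k)] vanishes at [t = 0], and its derivative there is the
     second derivative of [ell], which is positive, times [(dot (grad (f k) x) w)^2 = 1]. *)
  have grad0 : \forall t \near 0^'+, forall k, grad (Lk k) (x + t *: w) != 0.
    apply: filter_forall => k; have [dF DF] := Cn2_loss_k k.
    have dline := @is_derive_line _ _ _ x w 0 ((DF w).1 _).
    have := pos_derive_near_right (fun t => 'D_w (Lk k) (x + t *: w)) _ _ _ dline.
    rewrite scale0r addr0 (derive2_zero_loss _ _ (ell2 (y k)) (f2 k) x (ell'0 k)).
    rewrite (derive_comp _ _ (ell2 (y k)) (f2 k)) ell'0 mul0r.
    rewrite derive_dot ?w1; last exact: (f2 k).1.
    rewrite !mulr1 => /(_ erefl (ell''0 k)); apply: filterS => t.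
    apply: contraTneq => g0; rewrite derive_dot// g0 /dot big1 ?ltxx// => i _.
    by rewrite mxE mul0r.
  have near_w : \forall t \near 0^'+, N (x + t *: w) /\ forall k,
      (sharp_max (Lk k) rho (x + t *: w) <= (rho ^+ 2 * (sharp_coef D Max * T k + d))%:E)%E.
    exact: cvgx _ (filterI nN h).
  near (0 : R)^'+ => t.
  have [Nt ht] : N (x + t *: w) /\ forall k,
      (sharp_max (Lk k) rho (x + t *: w) <= (rho ^+ 2 * (sharp_coef D Max * T k + d))%:E)%E.
    by near: t.
  have gt : forall k, grad (Lk k) (x + t *: w) != 0 by near: t.
  exists (x + t *: w) => //; rewrite -averageE; apply: stoch_sharp_le => k.
  by apply: le_trans (ht k); exact: sharp_asc_le_max.
- have : \forall rho \near 0^'+, forall k,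
    (sharp_avg (Lk k) rho x <= (rho ^+ 2 * (sharp_coef D Avg * T k + d))%:E)%E.
    apply: filter_forall => k.
    exact: (sharp_avg_zero_loss_le _ _ (ell2 (y k)) (f2 k) D_gt0 x (ell'0 k) d d0).
  apply: filterS => rho h N nN; exists x; first exact: nbhs_singleton.
  by rewrite -averageE; exact: stoch_sharp_le.
Unshelve. all: by end_near. Qed.

End at_interpolation_point.

Lemma stoch_sharp_weak t (x : 'rV[R]_D) (d : R) : 0 < d ->
  \forall x' \near x & rho \near 0^'+, ((- d)%:E <= stoch_sharp t Lk rho x')%E.
Proof.
move=> d0.
have /filter_forall : forall k, \forall x' \near x & rho \near 0^'+,
    ((- d)%:E <= sharp t (Lk k) rho x')%E.
  move=> k; apply: sharp_lower_weak => //.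
  exact: Cn_continuous (Cn2_loss_k k).
apply: filterS => -[x' rho] /= h.
rewrite [X in X%:E](_ : _ = M%:R^-1 * \sum_(k < M) (- d)); first exact: le_stoch_sharp.
by rewrite sumr_const card_ord -(mulr_natl (- d)) mulKf //; exact: M0.
Qed.

End interpolation.

Theorem theorem5p3 (R : realType) (D M : nat) (M_gt0 : (0 < M)%N)
  (f : 'I_M -> 'rV[R]_D -> R) (f_C4 : forall k, Cn 4 (f k))
  (y : 'I_M -> R)
  (ell : R -> R -> R)
  (ell_C4 : forall b, Cn 4 (fun a : R^o => ell a b))
  (ell_argmin : forall b, [set a | forall a', ell a b <= ell a' b] = [set b])
  (ell_curv : forall b, 0 < derive1n 2 (fun a => ell a b) b)
  (Gamma_neq0 : interp_manifold f y !=set0) :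
  let Lk := loss_k ell f y in
  let L := loss ell f y in
  let Gamma := interp_manifold f y in
  exists S : sharpness -> 'rV[R]_D -> R,
    [/\ forall t, limiting_regularizer Gamma (stoch_sharp t Lk) (S t),
        forall x, [/\ S Max x = \tr (hessian L x) / 2,
                      S Asc x = \tr (hessian L x) / 2 &
                      D%:R * S Avg x = \tr (hessian L x) / 2] &
        forall U' : set 'rV[R]_D,
          bounded_set U' -> open U' ->
          closure U' `<=` attraction_set L Gamma ->
          closure U' `&` Gamma `<=` closure (U' `&` Gamma) ->
          U' `&` Gamma !=set0 ->
        forall (t : sharpness) (eps : R), 0 < eps ->
        exists omega : R -> R,
          [/\ forall rho, 0 < rho -> 0 < omega rho,
              omega rho @[rho --> 0^'+] --> 0 &
              \forall rho \near 0^'+, forall u, U' u ->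
                ((L u)%:E + stoch_sharp t Lk rho u <=
                  ereal_inf [set (L x)%:E + stoch_sharp t Lk rho x | x in U']
                  + (eps * rho ^+ 2)%:E)%E ->
                ((L u)%:E - ereal_inf [set (L x)%:E | x in U'] <=
                  (eps * rho ^+ 2 + omega rho * rho ^+ 2)%:E)%E /\
                (`| (S t u)%:E - ereal_inf [set (S t x)%:E | x in U' `&` Gamma] |
                  <= (eps + omega rho)%:E)%E]].
Proof.
move=> Lk L Gamma.
have f2 k : Cn 2 (f k) by exact/CnS/CnS.
have ell2 b : Cn 2 (fun a : R^o => ell a b) by exact/CnS/CnS.
(* In dimension 0 a matrix with [M > 0] rows has no right inverse, so [Gamma] would be empty. *)
have D_gt0 : (0 < D)%N.
  have [x [_ /row_freeP[B AB]]] := Gamma_neq0; rewrite lt0n; apply/eqP => D0.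
  have := congr1 (fun A : 'M[R]_M => A (Ordinal M_gt0) (Ordinal M_gt0)) AB.
  rewrite !mxE big1 => [/eqP|i _]; first by rewrite eqxx eq_sym oner_eq0.
  by exfalso; move: (ltn_ord i); rewrite [X in (_ < X)%N]D0 ltn0.
pose S t x : R := sharp_coef D t * \tr (hessian L x).
have S_ge t x d : Gamma x -> 0 < d -> \forall x' \near x & rho \near 0^'+,
    ((rho ^+ 2 * (S t x - d))%:E <= stoch_sharp t Lk rho x')%E.
  by move=> Gx; exact: (stoch_sharp_interp_ge M_gt0 f y ell f2 ell2 ell_argmin).
have S_le t x d : Gamma x -> 0 < d -> \forall rho \near 0^'+, forall N, nbhs x N ->
    exists2 x', N x' & (stoch_sharp t Lk rho x' <= (rho ^+ 2 * (S t x + d))%:E)%E.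
  by move=> Gx; exact: (stoch_sharp_interp_le M_gt0 f y ell f2 ell2 ell_argmin).
exists S; split.
- by move=> t; apply: limiting_regularizer_of_bounds => x d; [exact: S_ge|exact: S_le].
- move=> x; rewrite /S /sharp_coef; split; [by rewrite mulrC|by rewrite mulrC|].
  by field; rewrite pnatr_eq0 -lt0n.
move=> U' U'b U'o U'sub U'G U'G0 t eps eps0.
have S_cont : continuous (S t).
  move=> x; apply: (@cvgM _ _ (nbhs x) (nbhs_filter x)); first exact: cvg_cst.
  exact: trace_hessian_loss_continuous.
(* The conclusion with [d] in place of [omega rho], monotone in [d] as [exists_vanishing_rate]
   requires. *)
pose P (rho d : R) := forall u, U' u ->
  ((L u)%:E + stoch_sharp t Lk rho u <=
    ereal_inf [set (L x)%:E + stoch_sharp t Lk rho x | x in U']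
    + (eps * rho ^+ 2)%:E)%E ->
  ((L u)%:E - ereal_inf [set (L x)%:E | x in U'] <=
    (eps * rho ^+ 2 + d * rho ^+ 2)%:E)%E /\
  (`| (S t u)%:E - ereal_inf [set (S t x)%:E | x in U' `&` Gamma] |
    <= (eps + d)%:E)%E.
have [rho d1 d2 d12 Pd u Uu uE|d d0|omega [omega0 omega_cvg Pomega]] :=
  exists_vanishing_rate P.
- have [Lu Su] := Pd u Uu uE; split.
    by apply: (le_trans Lu); rewrite lee_fin lerD2l ler_wpM2r ?sqr_ge0.
  by apply: (le_trans Su); rewrite lee_fin lerD2l.
- apply: (near_minimizer_bounds Gamma (stoch_sharp t Lk) (S t) _ _ L
    (M%:R^-1 * \sum_k ell (y k) (y k))) => //.
  + exact: S_ge.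
  + exact: S_le.
  + exact: Cn_continuous (Cn2_loss f y ell f2 ell2).
  + exact: loss_min.
  + by move=> x [fx _]; exact: loss_interp.
  + move=> x Gx; rewrite mulr_ge0//; last exact: (trace_hessian_interp_ge0 f y ell).
    by rewrite /sharp_coef; case: (t); rewrite invr_ge0// mulr_ge0.
  + by move=> x e; exact: stoch_sharp_weak.
  + move=> x clx.
      exact: (minimum_interp_manifold M_gt0 f y ell f2 ell2 ell_argmin x (U'sub _ clx)).
- by exists omega.
Qed.
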